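(* Let $p\in(0,1)$ and $\alpha\in(0,1)$, and define, for $t\in\mathbb{N}$ and $x\in(0,1)$, $$f_t(x) := 1.5\sqrt{x(1-x)\,\ell(t)} + 0.8\,\ell(t),\qquad \ell(t) := \frac{1.4\log\log(2.1t)+\log(10/\alpha)}{t}.$$ Then $$\mathbb{P}\Big(\exists t\in\mathbb{N}:\ Q^-(p) < \widehat{Q}_t\big(p-f_t(1-p)\big)\ \text{ or }\ Q(p) > \widehat{Q}^-_t\big(p+f_t(p)\big)\Big)\le \alpha.$$ The same holds with $f_t$ replaced by $\widetilde f_t$, where, for any fixed tuning parameter $r>0$, $$\widetilde f_t(x) := \frac1t\,\sup\Big\{ s\in\Big[0,\frac{r+x(1-x)t}{x}\Big):\ M_{x,r}\big(s,\,x(1-x)t\big) < \frac1\alpha\Big\},$$ $$M_{x,r}(s,v) := \frac{1}{x^{v/(1-x)+s}(1-x)^{v/x-s}}\cdot\frac{B\big(\frac{r+v}{x}-s,\ \frac{r+v}{1-x}+s\big)}{B\big(\frac{r}{x},\ \frac{r}{1-x}\big)},$$ and $B(a,b)=\int_0^1 u^{a-1}(1-u)^{b-1}\,du$ is the beta function.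
   Context: $(X_i)_{i=1}^\infty$ is a sequence of i.i.d. observations taking values in a complete, totally ordered set $(\mathcal{X},\le)$. $F(x):=\mathbb{P}(X_1\le x)$ is the cumulative distribution function, and $\widehat F_t(x):=t^{-1}\sum_{i=1}^t \mathbf{1}\{X_i\le x\}$ is the empirical CDF. The upper and lower quantile functions are $Q(p):=\sup\{x\in\mathcal{X}:F(x)\le p\}$ and $Q^-(p):=\sup\{x\in\mathcal{X}:F(x)<p\}$. The upper and lower empirical quantile functions are $\widehat Q_t(p):=\sup\{x\in\mathcal{X}:\widehat F_t(x)\le p\}$ and $\widehat Q^-_t(p):=\sup\{x\in\mathcal{X}:\widehat F_t(x)<p\}$, extended to all $p\in\mathbb{R}$ with the convention that the supremum of the empty set is $\inf\mathcal{X}$, so that $\widehat Q_t(p)=\widehat Q^-_t(p)=\inf\mathcal{X}$ for $p<0$ and $\widehat Q_t(p)=\widehat Q^-_t(p)=\sup\mathcal{X}$ for $p>1$ (for $\mathcal{X}=\mathbb{R}$ these are $-\infty$ and $+\infty$).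
   Formalization: Added assumption: for every nonempty set S of points, P(X_1 ≤ s for some s in S) = sup of F on S and P(X_1 ≤ s for all s in S) = inf of F on S. It is automatic for real observations; without it the claim fails, e.g. on the ordinal ω_1+1. *)

(* Defs.v *)
From HB Require Import structures.
From mathcomp Require Import all_boot all_order all_algebra.
From mathcomp Require Import finmap.
From mathcomp Require Import all_classical all_reals all_analysis.
Import Order.TTheory GRing.Theory Num.Theory.
Import numFieldNormedType.Exports.
Set Implicit Arguments.
Unset Strict Implicit.
Unset Printing Implicit Defensive.
Local Open Scope classical_set_scope.
Local Open Scope ring_scope.

Section order_completion.
Context {dX : Order.disp_t} {X : orderType dX}.
Implicit Types (S : set X) (a b : extended X).

(* Completeness in the sense of the real line: end points may be missing. *)
Definition dedekind_complete : Prop :=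
  forall S, has_sup S -> exists u : X, isLub S u.

(* The library orders [extended X] only when [X] is a numeric domain; here [X]
   is an arbitrary total order. *)
Definition ext_lt a b : bool :=
  match a, b with
  | EFin x, EFin y => (x < y)%O
  | EFin _, EPInf | ENInf, EFin _ | ENInf, EPInf => true
  | _, _ => false
  end.

(* Supremum in [X], possibly completed by -oo and +oo: the least upper bound in
   [X] if there is one, and otherwise -oo for the empty set, +oo for a nonempty
   set. As the least upper bounds of the empty set are the minima of [X], the
   supremum of the empty set is inf [X], and -oo (resp. +oo) is reached only if
   [X] has no minimum (resp. no maximum). *)
Definition ext_sup S : extended X :=
  xget (if S == set0 then -oo%E else +oo%E) [set (u%:E)%E | u in isLub S].

Definition order_rays : set (set X) :=
  [set A | exists a : X, A = [set x | (x < a)%O] \/ A = [set x | (a < x)%O]].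

End order_completion.

Arguments dedekind_complete {dX} X.
Arguments order_rays {dX} X.

Section quantiles.
Context {R : realType} {dX : Order.disp_t} {X : orderType dX}.
Implicit Types (G : X -> R) (q : R).

Definition upper_quantile G q : extended X := ext_sup [set x | G x <= q].

Definition lower_quantile G q : extended X := ext_sup [set x | G x < q].

End quantiles.

Section sample.
Context {d : measure_display} {Omega : measurableType d} {R : realType}.
Variable P : probability Omega R.
Context {dX : Order.disp_t} {X : orderType dX}.
Implicit Types (Y : Omega -> X) (xi : nat -> Omega -> X).

Definition order_measurable Y : Prop :=
  forall A : set X, <<s order_rays X >> A -> measurable (Y @^-1` A).

Definition mutually_independent xi : Prop :=
  forall (J : {fset nat}) (A : nat -> set X),
    (forall i, i \in J -> <<s order_rays X >> (A i)) ->
    P [set w | forall i, i \in J -> A i (xi i w)] =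
      (\prod_(i <- J) P (xi i @^-1` A i))%E.

Definition identically_distributed xi : Prop :=
  forall (i : nat) (A : set X), <<s order_rays X >> A ->
    P (xi i @^-1` A) = P (xi 0%N @^-1` A).

Definition iid xi : Prop :=
  [/\ forall i, order_measurable (xi i),
      mutually_independent xi & identically_distributed xi].

Definition cdf_of Y (x : X) : R := fine (P [set w | (Y w <= x)%O]).

(* [xi i] is the (i+1)-st observation. *)
Definition empirical_cdf xi (t : nat) (w : Omega) (x : X) : R :=
  (t%:R)^-1 * \sum_(i < t) (xi i w <= x)%O%:R.

(* The regularity of a cumulative distribution function in the order topology:
   right continuity, P(Y < a) as the left limit at a, limits 0 and 1 at missing
   end points. Countable additivity gives it as soon as every nonempty subset
   of [X] has countable cofinal and coinitial subsets
   ([regular_cdf_countable]), for instance for [X] = R; it may fail in orders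
   such as omega_1 + 1. *)
Definition regular_cdf Y : Prop :=
  forall S : set X, S !=set0 ->
    P [set w | exists2 s, S s & (Y w <= s)%O] =
      ereal_sup [set P [set w | (Y w <= s)%O] | s in S] /\
    P [set w | forall s, S s -> (Y w <= s)%O] =
      ereal_inf [set P [set w | (Y w <= s)%O] | s in S].

Lemma regular_cdf_countable Y : order_measurable Y ->
  (forall S : set X, S !=set0 ->
    (exists u : nat -> X, (forall n, S (u n)) /\
       forall s, S s -> exists n, (s <= u n)%O) /\
    (exists v : nat -> X, (forall n, S (v n)) /\
       forall s, S s -> exists n, (v n <= s)%O)) ->
  regular_cdf Y.
Proof.
move=> mY cof S S0; have [[u [Su uS]] [v [Sv vS]]] := cof S S0.
pose A (x : X) := [set w | (Y w <= x)%O].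
have mA x : measurable (A x).
  have -> : A x = ~` (Y @^-1` [set y | (x < y)%O]).
    by apply/seteqP; split => w; rewrite /A /= leNgt => /negP.
  by apply: measurableC; apply: mY; apply: sub_sigma_algebra; exists x; right.
have leA x y : (x <= y)%O -> A x `<=` A y.
  by move=> xy w /= wx; exact: le_trans wx xy.
pose a := fix a n := if n is m.+1 then Order.max (a m) (u m) else u 0%N.
pose b := fix b n := if n is m.+1 then Order.min (b m) (v m) else v 0%N.
have Sa n : S (a n).
  by elim: n => [|n IH] /=; [exact: Su | case: (leP (a n) (u n)) => _].
have Sb n : S (b n).
  by elim: n => [|n IH] /=; [exact: Sv | case: (leP (b n) (v n)) => _].
have aS s : S s -> exists n, (s <= a n)%O.
  by move=> /uS[n sn]; exists n.+1 => /=; rewrite le_max sn orbT.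
have bS s : S s -> exists n, (b n <= s)%O.
  by move=> /vS[n sn]; exists n.+1 => /=; rewrite ge_min sn orbT.
have homa : {homo (A \o a) : n m / (n <= m)%N >-> (n <= m)%O}.
  apply: homo_leq => [//|y x z|n]; first exact: le_trans.
  by apply/subsetPset; apply: leA => /=; rewrite le_max lexx.
have homb : {homo (A \o b) : n m / (n <= m)%N >-> (m <= n)%O}.
  apply: (@homo_leq _ _ (fun x y => y <= x)%O) => [//|y x z xy yz|n].
    exact: le_trans yz xy.
  by apply/subsetPset; apply: leA => /=; rewrite ge_min lexx.
have le_mA x y : (x <= y)%O -> (P (A x) <= P (A y))%E.
  by move=> xy; apply: le_measure; rewrite ?inE; [exact: mA|exact: mA|exact: leA].
split.
- have -> : [set w | exists2 s, S s & (Y w <= s)%O] = \bigcup_n (A \o a) n.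
    apply/seteqP; split => w /=.
      by move=> [s /aS[n sn] ws]; exists n => //=; exact: le_trans ws sn.
    by move=> [n _ /= ?]; exists (a n).
  have c1 := @nondecreasing_cvg_mu _ _ _ P _ (fun n => mA (a n))
    (bigcup_measurable (fun n _ => mA (a n))) homa.
  have c2 : P \o (A \o a) @ \oo --> ereal_sup (range (P \o (A \o a))).
    apply: ereal_nondecreasing_cvgn => m n mn; apply: le_measure;
      rewrite ?inE; [exact: mA|exact: mA|exact/subsetPset/homa].
  have -> := cvg_unique (@ereal_hausdorff R) c1 c2.
  apply/eqP; rewrite eq_le; apply/andP; split; apply: ge_ereal_sup.
    by move=> _ [n _ <-]; apply: ereal_sup_ubound; exists (a n).
  move=> _ [s /aS[n sn] <-]; apply: (le_trans (le_mA _ _ sn)).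
  by apply: ereal_sup_ubound; exists n.
- have -> : [set w | forall s, S s -> (Y w <= s)%O] = \bigcap_n (A \o b) n.
    apply/seteqP; split => w /=; first by move=> + n _; apply.
    by move=> wb s /bS[n ns]; exact: le_trans (wb n I) ns.
  have fin : (P ((A \o b) 0%N) < +oo)%E.
    by rewrite (le_lt_trans (probability_le1 P (mA _))) // ltry.
  have c1 := @nonincreasing_cvg_mu _ _ _ P _ fin (fun n => mA (b n))
    (bigcap_measurable (ex_intro _ 0%N I) (fun n _ => mA (b n))) homb.
  have c2 : P \o (A \o b) @ \oo --> ereal_inf (range (P \o (A \o b))).
    apply: ereal_nonincreasing_cvgn => m n mn; apply: le_measure;
      rewrite ?inE; [exact: mA|exact: mA|exact/subsetPset/homb].
  have -> := cvg_unique (@ereal_hausdorff R) c1 c2.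
  apply/eqP; rewrite eq_le; apply/andP; split; apply: le_ereal_inf_tmp.
    move=> _ [s /bS[n ns] <-]; apply: (le_trans _ (le_mA _ _ ns)).
    by apply: ereal_inf_lbound; exists n.
  by move=> _ [n _ <-]; apply: ereal_inf_lbound; exists (b n).
Qed.

End sample.

Section radii.
Context {R : realType}.
Implicit Types (alpha r x s v a b : R) (t : nat).

Definition ell alpha t : R :=
  (14 / 10 * ln (ln (21 / 10 * t%:R)) + ln (10 / alpha)) / t%:R.

Definition stitched_radius alpha t x : R :=
  15 / 10 * Num.sqrt (x * (1 - x) * ell alpha t) + 8 / 10 * ell alpha t.

(* The library's [beta_fun] only takes natural parameters. *)
Definition beta_real a b : R :=
  (\int[lebesgue_measure]_(u in `[0%R, 1%R])
     (u `^ (a - 1) * (1 - u) `^ (b - 1)))%R.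

Definition beta_mixture x r s v : R :=
  (x `^ (v / (1 - x) + s) * (1 - x) `^ (v / x - s))^-1 *
  (beta_real ((r + v) / x - s) ((r + v) / (1 - x) + s) /
   beta_real (r / x) (r / (1 - x))).

Definition mixture_radius alpha r t x : R :=
  (t%:R)^-1 *
  sup [set s : R | 0 <= s < (r + x * (1 - x) * t%:R) / x /\
                   beta_mixture x r s (x * (1 - x) * t%:R) < alpha^-1].

End radii.

(* Main.v *)
Require Import Defs.
From HB Require Import structures.
From mathcomp Require Import all_boot all_order all_algebra.
From mathcomp Require Import finmap.
From mathcomp Require Import ring lra.
From mathcomp Require Import all_classical all_reals all_analysis.
From mathcomp Require Import measurable_realfun.
Import Order.TTheory GRing.Theory Num.Theory.
Import numFieldNormedType.Exports.
Set Implicit Arguments.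
Unset Strict Implicit.
Unset Printing Implicit Defensive.
Local Open Scope classical_set_scope.
Local Open Scope ring_scope.

(** Why the theorem holds.

    Reduction to coin tosses.  Let [F] be the cumulative distribution function.
    An empirical quantile is decided by one order statistic, so each of the two
    miscoverage events at time [t] only involves the number of observations
    falling in a fixed lower set of [X]: the upper bound fails when at least
    [t * (p + f t p)] observations fall in [below_upper], the lower bound fails
    when at most [t * (p - f t (1 - p))] fall in [below_lower] ([upper_missE],
    [lower_missE]).  These sets have probability at most [p], resp. at least
    [p], and lower sets of a total order are nested ([letter_law_both]).  Each
    observation thus becomes a letter in [bool * bool], and the miscoverage
    event a statement on the words of letters, which also makes it measurable.
    When [F] jumps over [p] the two sets differ.  Instead of randomizing ties,
    the letters in the gap are given a value in [0, 1] that makes the mean of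
    the letter exactly [p]; off a null set the sum of these values lies between
    the two counts ([coin_between], [null_letter]).  It remains to bound the
    deviations of a sum of bounded independent variables of mean [p] from both
    sides.

    Deviations.  Everything rests on Ville's inequality for nonnegative
    functions of words whose conditional mean does not increase ([ville]).

    For the stitched radius, time is cut into the epochs [4 ^ k <= t < 4 ^ k.+1].
    On epoch [k] a Bernstein exponential supermartingale bounds the sum by a
    straight line ([chernoff_line]); with the right slope this line stays below
    the curved boundary on the whole epoch ([epoch_line]).  The error
    probabilities [alpha / 10 * epoch_log k `^ (- 7 / 5)] add up to at most
    [alpha / 2] ([epoch_weights_sum]), and each of the two sides costs
    [alpha / 2].

    For the mixture radius, likelihood ratios of coin tosses are averaged over
    a beta prior ([mixture_martingale]).  By the weighted inequality of
    arithmetic and geometric means this martingale dominates [beta_mixture]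
    even though the letters take non-integral values
    ([beta_mixture_le_martingale]).  Exchanging heads and tails leaves the
    mixture unchanged ([beta_mixtureC]), so one martingale controls both sides
    at total cost [alpha].  That the mixture has reached [1 / alpha] once the
    sum has reached the radius, and not only beyond it, follows from its
    convexity in [s] ([mixture_radius_le]). *)

(** * Suprema and lower sets in a complete total order *)

Definition lower_set (dX : Order.disp_t) (X : orderType dX) (D : set X) : Prop :=
  forall x y, (x <= y)%O -> D y -> D x.

Section order.
Context {dX : Order.disp_t} {X : orderType dX}.
Hypothesis X_complete : dedekind_complete X.
Implicit Types (A B D : set X) (m : extended X).

Lemma isLub_unique A u v : isLub A u -> isLub A v -> u = v.
Proof.
move=> [uu lu] [uv lv]; apply/eqP; rewrite eq_le.
by rewrite lu//= lv.
Qed.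

Lemma ext_supE A u : isLub A u -> ext_sup A = EFin u.
Proof.
move=> Au; rewrite /ext_sup; case: xgetP => [m _ [v Av <-]|/(_ (EFin u))].
  by rewrite (isLub_unique Av Au).
by case; exists u.
Qed.

Lemma ext_sup_nolub A : (forall u, ~ isLub A u) ->
  ext_sup A = if A == set0 then -oo%E else +oo%E.
Proof.
by move=> nA; rewrite /ext_sup; case: xgetP => // m _ [u /nA].
Qed.

Lemma ext_sup_mono A B : A `<=` B -> ~~ ext_lt (ext_sup B) (ext_sup A).
Proof.
move=> AB; apply/negP.
have [[b lb]|nB] := pselect (exists b, isLub B b).
  rewrite (ext_supE lb).
  have [[a la]|nA] := pselect (exists a, isLub A a).
    rewrite (ext_supE la)/= ltNge => /negP; apply.
    by apply: la.2 => x /AB; apply: lb.1.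
  rewrite ext_sup_nolub; last by move=> u lu; apply: nA; exists u.
  case: eqVneq => [//|/set0P A0] _; apply: nA; apply: X_complete; split => //.
  by exists b => x /AB; apply: lb.1.
rewrite ext_sup_nolub; last by move=> u lu; apply: nB; exists u.
case: eqVneq => [B0|_]; last by case: ext_sup.
have -> : A = B by apply/seteqP; split => // x; rewrite B0.
by rewrite ext_sup_nolub ?B0 ?eqxx// => u lu; apply: nB; exists u; rewrite B0.
Qed.

Lemma ext_le_lt_trans m1 m2 m3 : ~~ ext_lt m2 m1 -> ext_lt m2 m3 -> ext_lt m1 m3.
Proof.
case: m1 m2 m3 => [x| |] [y| |] [z| |] //=; rewrite -leNgt; exact: le_lt_trans.
Qed.

Lemma ext_lt_le_trans m1 m2 m3 : ext_lt m1 m2 -> ~~ ext_lt m3 m2 -> ext_lt m1 m3.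
Proof.
case: m1 m2 m3 => [x| |] [y| |] [z| |] //= xy; rewrite -leNgt; exact: lt_le_trans.
Qed.

Lemma lower_set_total A B : lower_set A -> lower_set B -> A `<=` B \/ B `<=` A.
Proof.
move=> lA lB; have [|nAB] := pselect (A `<=` B); [by left|right => y By].
have /existsNP[x /not_implyP[Ax nBx]] : ~ forall x, A x -> B x by [].
have [yx|/ltW xy] := leP y x; first exact: lA yx Ax.
by case: nBx; exact: lB xy By.
Qed.

(** A lower set is empty, everything, or a ray ending at its supremum, so
    completeness puts it in the sigma-algebra of the rays. *)
Lemma lower_set_sigma D : lower_set D -> <<s order_rays X >> D.
Proof.
move=> lD.
have [s0 sC sU] := smallest_sigma_algebra [set: X] (order_rays X).
have sR A : order_rays X A -> <<s order_rays X >> A by apply: sub_sigma_algebra.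
have sT : <<s order_rays X >> [set: X] by have := sC _ s0; rewrite setD0.
have [->|/set0P D0] := eqVneq D set0; first exact: s0.
have [[b Db]|nb] := pselect (has_ubound D); last first.
  suff -> : D = setT by [].
  apply/seteqP; split => // x _; apply: contrapT => nDx; apply: nb.
  exists x => y Dy; rewrite leNgt; apply/negP => /ltW xy; apply: nDx.
  exact: lD Dy.
have [u lu] : exists u, isLub D u by apply: X_complete; split => //; exists b.
have belowD x : (x < u)%O -> D x.
  move=> xu; apply: contrapT => nDx; move: xu; rewrite ltNge => /negP; apply.
  apply: lu.2 => y Dy; rewrite leNgt; apply/negP => /ltW xy; apply: nDx.
  exact: lD Dy.
have [Du|nDu] := pselect (D u).
  suff -> : D = setT `\` [set x | (u < x)%O].
    by apply: sC; apply: sR; exists u; right.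
  apply/seteqP; split => [x Dx|x [_ /negP]]; first split=> //.
    by apply/negP; rewrite -leNgt; exact: lu.1.
  by rewrite -leNgt => xu; exact: lD Du.
suff -> : D = [set x | (x < u)%O] by apply: sR; exists u; left.
apply/seteqP; split => [x Dx|x /belowD//]; rewrite /= lt_neqAle lu.1// andbT.
by apply/eqP => xu; apply: nDu; rewrite -xu.
Qed.

(** A monotone condition on counts holds for the lower sets that contain one
    sample point, the [k]-th smallest one, [k] being the least count that
    satisfies the condition. One point decides for all lower sets at once. *)
Lemma order_statistic (t : nat) (x : 'I_t -> X) (tau : pred nat) :
  (forall a b, (a <= b)%N -> tau a -> tau b) -> ~~ tau 0%N -> tau t ->
  exists y, forall D, lower_set D ->
    tau (\sum_(i < t) (x i \in D))%N = (y \in D).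
Proof.
move=> up tau0 taut.
pose c (D : set X) : nat := (\sum_(i < t) (x i \in D))%N.
have cS A B : A `<=` B -> (c A <= c B)%N.
  move=> AB; apply: leq_sum => i _; case: (boolP (x i \in A)) => //.
  by rewrite in_setE => /AB; rewrite -in_setE => ->.
have t0 : (0 < t)%N by case: t taut {x c cS} => // /(negP tau0).
pose le_ y := [set z : X | (z <= y)%O].
have topmost D : (0 < c D)%N -> exists2 i, D (x i) & c D = c (D `&` le_ (x i)).
  move=> cD.
  have [i0 Di0] : exists i, x i \in D.
    apply/existsP; apply: contraTT cD => /existsPn nD.
    by rewrite -leqNgt leqn0 /c big1// => i _; rewrite (negbTE (nD i)).
  have [i Di imax] := @arg_maxP _ _ _ i0 (fun i => x i \in D) x Di0.
  exists i; first exact/set_mem.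
  apply: eq_bigr => j _; congr nat_of_bool; apply/idP/idP.
    by move=> Dj; rewrite in_setE; split; [exact/set_mem|exact: imax].
  by rewrite !in_setE => -[].
have [i Pi imin] : exists2 i, tau (c (le_ (x i))) &
    forall j, tau (c (le_ (x j))) -> (x i <= x j)%O.
  have [i0 _ ci0] : exists2 i, setT (x i) & c setT = c (setT `&` le_ (x i)).
    apply: topmost; rewrite /c (eq_bigr (fun=> 1%N)); last by move=> i _; rewrite in_setT.
    by rewrite sum_nat_const card_ord muln1.
  have Pi0 : tau (c (le_ (x i0))).
    rewrite setTI in ci0; rewrite -ci0 /c (eq_bigr (fun=> 1%N)); last first.
      by move=> i _; rewrite in_setT.
    by rewrite sum_nat_const card_ord muln1.
  have [i Di imax] := @arg_minP _ _ _ i0 (fun i => tau (c (le_ (x i)))) x Pi0.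
  by exists i.
exists (x i) => D lD; apply/idP/idP; last first.
  rewrite in_setE => Dx; apply: up Pi; apply: cS => z /= zx; exact: lD Dx.
move=> tD.
have cD : (0 < c D)%N by rewrite lt0n; apply: contraNneq tau0 => <-.
have [j Dj cj] := topmost _ cD.
rewrite in_setE; apply: lD (Dj); apply: imin; apply: up tD.
by rewrite -/(c D) cj; apply: cS => z [].
Qed.

Lemma count_ray (t : nat) (x : 'I_t -> X) (tau : pred nat) y :
  (forall D, lower_set D -> tau (\sum_(i < t) (x i \in D))%N = (y \in D)) ->
  [set z | ~~ tau (\sum_(i < t) (x i \in [set u | (u <= z)%O]))%N] =
  [set z | (z < y)%O].
Proof.
move=> yP; apply/seteqP; split => z /=;
  (rewrite yP; last by move=> u v uv; exact: le_trans).
  by move=> /negP h; rewrite ltNge; apply/negP => yz; apply: h; exact: mem_set.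
by move=> zy; apply/negP => /set_mem /=; rewrite leNgt zy.
Qed.

End order.

(** * Words of independent letters and Ville's inequality *)

Section words.
Context {d : measure_display} {Omega : measurableType d} {R : realType}.
Variable P : probability Omega R.
Context {T : finType}.
Implicit Types (Z : nat -> Omega -> T) (W : seq T -> R) (mu : T -> R).

Definition word Z (t : nat) (w : Omega) : seq T := mkseq (Z^~ w) t.

(** The law is required on cylinders only: this is what the induction behind
    Ville's inequality uses. *)
Definition iid_letters Z mu : Prop :=
  (forall i c, measurable [set w | Z i w = c]) /\
  forall s, P [set w | word Z (size s) w = s] = (\prod_(c <- s) mu c)%:E.

Lemma measurable_word Z (Q : seq T -> Prop) t :
  (forall i c, measurable [set w | Z i w = c]) ->
  measurable [set w | Q (word Z t w)].
Proof.
move=> mZ; elim: t Q => [|t IH] Q.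
  have [q|nq] := pselect (Q [::]).
    by rewrite (_ : [set w | _] = setT)//; apply/seteqP; split.
  by rewrite (_ : [set w | _] = set0)//; apply/seteqP; split.
rewrite (_ : [set w | _] = \bigcup_(c in [set: T])
    ([set w | Q (rcons (word Z t w) c)] `&` [set w | Z t w = c])).
  apply: fin_bigcup_measurable => [|c _]; first exact: finite_finset.
  by apply: measurableI => //; exact: (IH (fun s => Q (rcons s c))).
apply/seteqP; split => w /=.
  by rewrite /word mkseqS => Qw; exists (Z t w).
by move=> [c _ [/= Qw Zc]]; rewrite /word mkseqS Zc.
Qed.

Lemma measurable_word_ex Z (Q : nat -> seq T -> Prop) :
  (forall i c, measurable [set w | Z i w = c]) ->
  measurable [set w | exists t, Q t (word Z t w)].
Proof.
move=> mZ; rewrite [X in measurable X](_ : _ = \bigcup_t [set w | Q t (word Z t w)]).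
  by apply: bigcup_measurable => t _; exact: measurable_word.
by apply/seteqP; split => w /= [t]; [exists t|move=> _ ?; exists t].
Qed.

Lemma measure_bigsetU_le (r : seq T) (A : T -> set Omega) :
  (forall c, measurable (A c)) ->
  (P (\big[setU/set0]_(c <- r) A c) <= \sum_(c <- r) P (A c))%E.
Proof.
move=> mA; elim: r => [|c r IH]; first by rewrite !big_nil measure0.
rewrite !big_cons; apply: le_trans (leeD2l _ IH).
by apply: measureU2 => //; exact: bigsetU_measurable.
Qed.

(** Backward induction on the horizon [n]: if the word [s] has not crossed [c],
    a crossing within [n.+1] letters is a crossing within [n] letters after one
    more letter, and averaging over this letter does not increase [W]. *)
Lemma ville_cylinder Z mu W (c : R) (n : nat) (s : seq T) :
  iid_letters Z mu -> (forall a, 0 <= mu a) -> (forall s, 0 <= W s) ->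
  (forall s, \sum_a mu a * W (rcons s a) <= W s) -> 0 < c ->
  (P [set w | word Z (size s) w = s /\ exists2 t, (size s <= t <= size s + n)%N &
       (c <= W (word Z t w))%R] <= ((\prod_(a <- s) mu a) * (W s / c))%:E)%E.
Proof.
move=> [mZ PZ] mu0 W0 Wsuper c0.
have mev m s' : measurable [set w | word Z (size s') w = s' /\
    exists2 t, (size s' <= t <= size s' + m)%N & c <= W (word Z t w)].
  apply: measurableI; first exact: (measurable_word (fun u => u = s')).
  rewrite [X in measurable X](_ : _ =
      \bigcup_(t in [set t | (size s' <= t <= size s' + m)%N])
        [set w | c <= W (word Z t w)]); last first.
    by apply/seteqP; split => w [t ? ?]; exists t.
  apply: bigcup_measurable => t _; exact: (measurable_word (fun u => c <= W u)).
elim: n s => [|n IH] s.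
all: have [cW|Wc] := leP c (W s).
1,3: apply: (@le_trans _ _ (P [set w | word Z (size s) w = s]));
  [apply: le_measure; rewrite ?inE; [exact: mev|exact: (measurable_word (fun u => u = s))|
   by move=> w []]
  |by rewrite PZ lee_fin ler_peMr ?prodr_ge0// ler_pdivlMr// mul1r].
- rewrite (_ : [set w | _] = set0) ?measure0.
    by rewrite lee_fin mulr_ge0 ?prodr_ge0// divr_ge0// ltW.
  apply/seteqP; split => // w [/= ws [t]]; rewrite addn0 -eqn_leq => /eqP <-.
  by rewrite ws leNgt Wc.
pose A a := [set w | word Z (size (rcons s a)) w = rcons s a /\
    exists2 t, (size (rcons s a) <= t <= size (rcons s a) + n)%N & c <= W (word Z t w)].
apply: (@le_trans _ _ (P (\big[setU/set0]_(a <- enum T) A a))).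
  apply: le_measure; rewrite ?inE; [exact: mev|apply: bigsetU_measurable => a _; exact: mev|].
  move=> w [/= ws [t /andP[st tn] cW]]; rewrite -bigcup_seq /=.
  exists (Z (size s) w); first by rewrite /= mem_enum.
  rewrite /A /= size_rcons /word mkseqS -/(word Z (size s) w) ws; split => //.
  exists t => //; rewrite addSnnS tn andbT ltn_neqAle st andbT.
  by apply/eqP => ts; move: cW; rewrite -ts ws leNgt Wc.
apply: (le_trans (measure_bigsetU_le _ _)) => [a|]; first exact: mev.
apply: (@le_trans _ _ (\sum_(a <- enum T)
    ((\prod_(b <- s) mu b) * (mu a * W (rcons s a) / c))%:E)%E).
  apply: lee_sum => a _; apply: (le_trans (IH _)).
  by rewrite lee_fin -cats1 big_cat/= big_seq1 -mulrA ler_wpM2l ?prodr_ge0// mulrA.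
rewrite sumEFin lee_fin -mulr_sumr ler_wpM2l ?prodr_ge0// -mulr_suml.
by rewrite ler_pM2r ?invr_gt0// big_enum.
Qed.

(** Ville's maximal inequality, from the finite horizons by continuity of the
    measure along the increasing events. *)
Lemma ville Z mu W (c : R) :
  iid_letters Z mu -> (forall a, 0 <= mu a) -> (forall s, 0 <= W s) ->
  (forall s, \sum_a mu a * W (rcons s a) <= W s) -> 0 < c ->
  (P [set w | exists t, (c <= W (word Z t w))%R] <= (W [::] / c)%:E)%E.
Proof.
move=> hZ mu0 W0 Wsuper c0; have mZ := hZ.1.
pose A n := [set w | exists2 t, (t <= n)%N & c <= W (word Z t w)].
have mA n : measurable (A n).
  rewrite (_ : A n = \bigcup_(t in [set t | (t <= n)%N])
      [set w | c <= W (word Z t w)]); last first.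
    by apply/seteqP; split => w [t ? ?]; exists t.
  apply: bigcup_measurable => t _; exact: (measurable_word (fun u => c <= W u)).
have AE : [set w | exists t, c <= W (word Z t w)] = \bigcup_n A n.
  by apply/seteqP; split => w /= [t]; [exists t => //; exists t|move=> _ [m]; exists m].
have cvgA : P \o A @ \oo --> P (\bigcup_n A n).
  apply: nondecreasing_cvg_mu => //; first exact: bigcup_measurable.
  move=> m n mn; apply/subsetPset => w [t tm ct]; exists t => //; exact: leq_trans mn.
rewrite AE -(cvg_lim _ cvgA)//.
apply: lime_le; first by apply/cvg_ex; eexists; exact: cvgA.
near=> n => /=.
have := @ville_cylinder Z mu W c n [::] hZ mu0 W0 Wsuper c0.
rewrite big_nil mul1r; apply: le_trans; apply: le_measure; rewrite ?inE//.
  rewrite [X in measurable X](_ : _ = A n)//.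
  apply/seteqP; split => w /=; first by move=> [_ [t tn ct]]; exists t.
  by move=> [t tn ct]; split => //; exists t.
Unshelve. all: end_near. Qed.

End words.

(** * Bernstein's inequality and stitching over geometric epochs *)

Section real_inequalities.
Context {R : realType}.
Implicit Types (x y l t p : R).

Lemma exp_chord t x y : 0 <= t <= 1 ->
  expR (t * x + (1 - t) * y) <= t * expR x + (1 - t) * expR y.
Proof.
move=> /andP[t0 t1].
by have := @convex_expR R (Itv01 t0 t1) x y; rewrite !convRE/=.
Qed.

Lemma is_derive_ge0_le (f df : R -> R) :
  (forall x, is_derive x 1 f (df x)) -> (forall x, 0 <= x -> 0 <= df x) ->
  forall x, 0 <= x -> f 0 <= f x.
Proof.
move=> fdf df0 x x0.
have cf : continuous f.
  by move=> y; apply/differentiable_continuous/derivable1_diffP; case: (fdf y).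
have [c] := @MVT_segment R f df 0 x x0 (fun y _ => fdf y) (continuous_subspaceT cf).
by rewrite in_itv/= => /andP[c0 _]; rewrite -subr_ge0 => ->; rewrite mulr_ge0 ?df0// subr0.
Qed.

Lemma ln_ge1BV x : 0 < x -> 1 - x^-1 <= ln x.
Proof.
move=> x0; have := @le_ln1Dx R (x^-1 - 1).
rewrite addrCA subrr addr0 lnV ?posrE// => /(_ _); rewrite ltrBDr addNr invr_gt0 => /(_ x0).
lra.
Qed.

(** The Bernstein condition for a variable bounded by 1: the power series
    [\sum_(j >= 2) l ^+ j / j!] is dominated by a geometric one of ratio [l / 3].
    Two differentiations reduce the inequality to [1 - l <= expR (- l)]. *)
Lemma exp_bernstein l : 0 <= l -> (1 - l / 3) * (expR l - 1 - l) <= l ^+ 2 / 2.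
Proof.
move=> l0.
pose f (l : R) := l ^+ 2 / 2 - (1 - l / 3) * (expR l - 1 - l).
pose g (l : R) := 2 * l + (l - 2) * (expR l - 1).
pose dg (l : R) := 1 + (l - 1) * expR l.
have fE x : is_derive x 1 f (g x / 3).
  rewrite /f /g; apply: is_derive_eq; rewrite /GRing.scale/=; by field.
have gE x : is_derive x 1 g (dg x).
  rewrite /g /dg; apply: is_derive_eq; rewrite /GRing.scale/=; by ring.
have dg0 x : 0 <= x -> 0 <= dg x.
  move=> x0; rewrite /dg; have := expR_ge1Dx (- x); rewrite expRN => h.
  suff : (1 - x) * expR x <= 1 by lra.
  by rewrite -ler_pdivlMr ?expR_gt0// div1r; lra.
have g0 x : 0 <= x -> 0 <= g x / 3.
  move=> x0; rewrite divr_ge0//; apply: le_trans (is_derive_ge0_le gE dg0 x0).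
  by rewrite /g expR0; lra.
have := is_derive_ge0_le fE g0 l0.
by rewrite /f expR0; lra.
Qed.

(** Both sides agree at [l = 0]; the derivative of the difference is
    [p * (1 - p) * (expR l - 1) * (1 - expR (- (l * p)))], hence nonnegative. *)
Lemma bernoulli_exp_le p l : 0 <= p <= 1 -> 0 <= l ->
  (1 - p) * expR (- (l * p)) + p * expR (l * (1 - p)) <=
  1 + p * (1 - p) * (expR l - 1 - l).
Proof.
move=> /andP[p0 p1] l0.
pose f (l : R) := 1 + p * (1 - p) * (expR l - 1 - l)
  - (1 - p) * expR (- (l * p)) - p * expR (l * (1 - p)).
pose df (l : R) := p * (1 - p) * (expR l - 1 + expR (- (l * p)) - expR (l * (1 - p))).
have fE x : is_derive x 1 f (df x).
  rewrite /f /df; apply: is_derive_eq; rewrite /GRing.scale/=; by ring.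
have df0 x : 0 <= x -> 0 <= df x.
  move=> x0; rewrite /df mulr_ge0 ?mulr_ge0 ?subr_ge0//.
  have -> : x * (1 - p) = x + - (x * p) by ring.
  rewrite expRD.
  have E1 : 1 <= expR x by have := expR_ge1Dx x; lra.
  have F1 : expR (- (x * p)) <= 1 by rewrite expR_le1 oppr_le0 mulr_ge0.
  by nra.
have := is_derive_ge0_le fE df0 l0.
rewrite /f mul0r oppr0 mul0r expR0; lra.
Qed.

End real_inequalities.

Section bounded_letters.
Context {d : measure_display} {Omega : measurableType d} {R : realType}.
Variable P : probability Omega R.
Context {T : finType}.
Implicit Types (Z : nat -> Omega -> T) (mu phi : T -> R) (x l y : R).

Definition mean_letter mu phi (x : R) : Prop :=
  [/\ forall a, 0 <= mu a, \sum_a mu a = 1, forall a, 0 <= phi a <= 1 &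
      \sum_a mu a * phi a = x].

(** A variable in [0, 1] is dominated in the convex order by the coin toss of
    the same mean, for which the bound is Bernstein's. *)
Lemma bernstein_mgf mu phi x l : mean_letter mu phi x -> 0 <= x <= 1 ->
  0 <= l < 3 ->
  \sum_a mu a * expR (l * (phi a - x)) <=
  expR (x * (1 - x) * (l ^+ 2 / (2 * (1 - l / 3)))).
Proof.
move=> [mu0 mu1 phi01 muphi] x01 /andP[l0 l3].
have step : \sum_a mu a * expR (l * (phi a - x)) <=
    (1 - x) * expR (- (l * x)) + x * expR (l * (1 - x)).
  apply: (@le_trans _ _ (\sum_a (mu a * phi a * expR (l * (1 - x)) +
      (mu a - mu a * phi a) * expR (- (l * x))))).
    apply: ler_sum => a _.
    have -> : l * (phi a - x) = phi a * (l * (1 - x)) + (1 - phi a) * (- (l * x)).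
      by ring.
    have := exp_chord (l * (1 - x)) (- (l * x)) (phi01 a).
    by move=> /(ler_wpM2l (mu0 a)); lra.
  by rewrite big_split/= -!mulr_suml sumrB muphi mu1; lra.
apply: (le_trans step); apply: (le_trans (bernoulli_exp_le x01 l0)).
apply: le_trans (expR_ge1Dx _); rewrite lerD2l ler_wpM2l//; first nra.
by rewrite ler_pdivlMr; [have := exp_bernstein l0; lra|lra].
Qed.

Definition letter_sum phi (s : seq T) : R := \sum_(a <- s) phi a.

(** Ville's inequality for the exponential supermartingale
    [expR (l * (S - t * x) - t * psi)]. *)
Lemma chernoff_line Z mu phi x l psi y : iid_letters P Z mu ->
  mean_letter mu phi x -> \sum_a mu a * expR (l * (phi a - x)) <= expR psi ->
  (P [set w | exists t, (y <= l * (letter_sum phi (word Z t w) - t%:R * x) - t%:R * psi)%R]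
   <= (expR (- y))%:E)%E.
Proof.
move=> hZ [mu0 mu1 phi01 muphi] mgf.
pose W s := expR (l * (letter_sum phi s - (size s)%:R * x) - (size s)%:R * psi).
have Wrcons s a : W (rcons s a) = W s * (expR (l * (phi a - x)) * expR (- psi)).
  rewrite /W -!expRD; congr expR.
  rewrite /letter_sum -cats1 big_cat big_seq1 size_cat /= addn1 -natr1; ring.
have super s : \sum_a mu a * W (rcons s a) <= W s.
  under eq_bigr do rewrite Wrcons mulrCA mulrA mulrA.
  rewrite -mulr_suml -[leRHS]mulr1.
  under eq_bigr do rewrite -mulrA.
  rewrite -mulr_sumr -mulrA ler_wpM2l ?expR_ge0//.
  by rewrite expRN ler_pdivrMr ?expR_gt0// mul1r.
have W0 s : 0 <= W s by exact: expR_ge0.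
have Wnil : W [::] = 1 by rewrite /W /letter_sum big_nil !mul0r subrr mulr0 subrr expR0.
have := ville hZ mu0 W0 super (expR_gt0 y).
rewrite Wnil div1r -expRN.
apply: le_trans; apply: le_measure; rewrite ?inE.
- exact: (measurable_word_ex (fun t s =>
    y <= l * (letter_sum phi s - t%:R * x) - t%:R * psi) hZ.1).
- exact: (measurable_word_ex (fun=> fun s => expR y <= W s) hZ.1).
move=> w [t yt]; exists t; rewrite /W ler_expR.
by rewrite /word size_mkseq.
Qed.

End bounded_letters.

Section stitching.
Context {R : realType}.
Implicit Types (x l t n v r S L alpha : R).

(** The slope is Bernstein's choice for the variance [v * n] at the start of the
    epoch: with it the line is [l / 3 + l * r * (1 + w ^+ 2 / 2)], where
    [w = sqrt (t / n)] ranges over [1, 2], while the curve exceeds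
    [l / 3 + 3 / 2 * l * r * w]. Their comparison is
    [(w - 1) * (2 - w) >= 0]: the ratio 4 of the epochs and the constant 1.5 of
    the radius match exactly. *)
Lemma epoch_line v n t l L S : 0 < v -> 0 < n -> n <= t <= 4 * n -> 0 < l <= L ->
  15 / 10 * Num.sqrt (v * (t * L)) + 8 / 10 * L <= S ->
  forall r lam, r = Num.sqrt (v * n / l) -> lam = (3^-1 + r)^-1 ->
  l <= lam * S - t * (v * (lam ^+ 2 / (2 * (1 - lam / 3)))).
Proof.
move=> v0 n0 /andP[nt tn] /andP[l0 lL] HS r lam rE lamE.
have r0 : 0 < r by rewrite rE sqrtr_gt0 divr_gt0// mulr_gt0.
have r2 : v * n = l * r ^+ 2.
  by rewrite rE sqr_sqrtr ?divr_ge0 ?mulr_ge0 ?ltW// mulrCA divff ?mulr1// gt_eqF.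
pose w := Num.sqrt (t / n).
have w2 : t = n * w ^+ 2.
  by rewrite sqr_sqrtr ?divr_ge0 ?(le_trans (ltW n0))// 1?ltW// mulrCA divff ?mulr1// gt_eqF.
have w0 : 0 <= w by exact: sqrtr_ge0.
have w1 : 1 <= w by rewrite -[leLHS]sqrtr1 ler_wsqrtr// ler_pdivlMr// mul1r.
have w4 : w <= 2.
  have -> : 2 = Num.sqrt (2 ^+ 2) :> R by rewrite sqrtr_sqr ger0_norm.
  by rewrite ler_wsqrtr// ler_pdivrMr// (le_trans tn)// -natrX.
have sqrt_ge : l * r * w <= Num.sqrt (v * (t * L)).
  have nn : 0 <= l * r * w by rewrite !mulr_ge0// ltW.
  rewrite -[leLHS](ger0_norm nn) -sqrtr_sqr ler_wsqrtr//.
  have -> : (l * r * w) ^+ 2 = v * (t * l).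
    rewrite !exprMn w2 mulrA mulrA r2; ring.
  by rewrite ler_pM2l// ler_pM2l// (lt_le_trans n0).
have lam0 : 0 < lam by rewrite lamE invr_gt0 addr_gt0.
have lamr : lam * (3^-1 + r) = 1 by rewrite lamE mulVf// gt_eqF// addr_gt0.
have -> : t * (v * (lam ^+ 2 / (2 * (1 - lam / 3)))) = lam * (l * r * w ^+ 2 / 2).
  have -> : 1 - lam / 3 = lam * r by move: lamr; rewrite mulrDr; lra.
  have -> : t * (v * (lam ^+ 2 / (2 * (lam * r)))) = v * n * w ^+ 2 * (lam ^+ 2 / (2 * (lam * r))).
    by rewrite w2; ring.
  by rewrite r2; field; rewrite !gt_eqF.
have lE : l = lam * ((3^-1 + r) * l) by rewrite mulrA lamr mul1r.
rewrite -mulrBr [leLHS]lE ler_pM2l// mulrDl lerBrDr.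
apply: le_trans HS.
have : 0 <= l * r * ((w - 1) * (2 - w)).
  by apply: mulr_ge0; rewrite mulr_ge0 ?subr_ge0// ltW.
lra.
Qed.

(** A rational lower bound for [ln (21 / 10 * t)] valid for all [t >= 4 ^ k],
    from [7 / 10 <= ln (21 / 10)] and [5 / 4 <= ln 4]. *)
Definition epoch_log (k : nat) : R := 7 / 10 + 5 / 4 * k%:R.

Lemma epoch_log_gt0 k : 0 < epoch_log k.
Proof. by rewrite ltr_wpDr// mulr_ge0. Qed.

Lemma epoch_log_le (k t : nat) : (4 ^ k <= t)%N ->
  epoch_log k <= ln (21 / 10 * t%:R :> R).
Proof.
move=> kt.
(* Numerically, (100 / 93) ^ 10 < 21 / 10, and ln (93 / 100) <= - 7 / 100. *)
have l21 : 7 / 10 <= ln (21 / 10 : R).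
  apply: (@le_trans _ _ (ln ((93 / 100 : R)^-1 ^+ 10))).
    rewrite lnXn// lnV ?posrE//.
    have := @le_ln1Dx R (- (7 / 100)); rewrite [1 - _](_ : _ = 93 / 100); last by lra.
    by rewrite -mulr_natr => /(_ ltac:(lra)); lra.
  by rewrite ler_ln ?posrE ?exprn_gt0 ?invr_gt0//; lra.
(* Likewise (8 / 7) ^ 10 < 4 and ln (7 / 8) <= - 1 / 8. *)
have l4 : 5 / 4 <= ln (4 : R).
  apply: (@le_trans _ _ (ln ((7 / 8 : R)^-1 ^+ 10))).
    rewrite lnXn// lnV ?posrE//.
    have := @le_ln1Dx R (- (1 / 8)); rewrite [1 - _](_ : _ = 7 / 8); last by lra.
    by rewrite -mulr_natr => /(_ ltac:(lra)); lra.
  by rewrite ler_ln ?posrE ?exprn_gt0 ?invr_gt0//; lra.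
apply: (@le_trans _ _ (ln (21 / 10 * 4 ^+ k))).
  rewrite lnM ?posrE ?exprn_gt0// lnXn// lerD// -[leRHS]mulr_natr.
  by rewrite ler_wpM2r.
rewrite ler_ln ?posrE ?mulr_gt0 ?exprn_gt0// ?ltr0n ?(leq_trans _ kt) ?expn_gt0//.
by rewrite ler_wpM2l// -natrX ler_nat.
Qed.

(** Comparison of [\sum_k (epoch_log k) `^ (- 7 / 5)] with the integral of
    [x `^ (- 7 / 5)]: a step of the sum costs at most twice the decrease of
    [x `^ (- 2 / 5)], so the sum telescopes. The first term is kept apart. *)
Lemma epoch_weights_sum (n : nat) :
  \sum_(k < n) expR (- (14 / 10 * ln (epoch_log k))) <= 5.
Proof.
pose g k := expR (- (4 / 10 * ln (epoch_log k))).
have e0 := epoch_log_gt0.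
have termE k : expR (- (14 / 10 * ln (epoch_log k))) = g k / epoch_log k.
  rewrite -[in RHS](lnK (e0 k)) -expRN -expRD; congr expR.
  lra.
have step k : g k.+1 / epoch_log k.+1 <= 2 * (g k - g k.+1).
  have gr : g k = g k.+1 * expR (4 / 10 * (ln (epoch_log k.+1) - ln (epoch_log k))).
    by rewrite /g -expRD; congr expR; lra.
  have h : 1 + 2^-1 / epoch_log k.+1 <=
      expR (4 / 10 * (ln (epoch_log k.+1) - ln (epoch_log k))).
    apply: le_trans (expR_ge1Dx _); rewrite lerD2l.
    rewrite -ln_div ?posrE//.
    have := ln_ge1BV (divr_gt0 (e0 k.+1) (e0 k)); rewrite invf_div.
    have -> : 1 - epoch_log k / epoch_log k.+1 = 5 / 4 / epoch_log k.+1.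
      rewrite -{1}(@divff _ (epoch_log k.+1)) ?gt_eqF// -mulrBl; congr (_ / _).
      by rewrite /epoch_log -[in k.+1%:R]natr1; lra.
    lra.
  rewrite gr; have := ler_wpM2l (ltW (expR_gt0 _) : 0 <= g k.+1) h; lra.
have tele m : \sum_(k < m.+1) g k / epoch_log k <= g 0%N / (7 / 10) + 2 * (g 0%N - g m).
  elim: m => [|m IH]; first by rewrite big_ord1/= /epoch_log mulr0 addr0 subrr mulr0 addr0.
  by rewrite big_ord_recr/=; have := step m; lra.
have g0 : g 0%N <= 10 / 7.
  have l7 : ln (7 / 10 : R) < 0 by apply: ln_lt0; lra.
  rewrite /g /epoch_log mulr0 addr0.
  apply: (@le_trans _ _ (expR (- ln (7 / 10)))); first by rewrite ler_expR; lra.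
  by rewrite expRN lnK ?posrE//; lra.
under eq_bigr do rewrite termE.
case: n => [|n]; first by rewrite big_ord0.
apply: (le_trans (tele n)); have : 0 <= g n by exact: expR_ge0.
lra.
Qed.

(** The logarithm of the inverse of the error probability spent on epoch [k]. *)
Definition epoch_level alpha (k : nat) : R :=
  14 / 10 * ln (epoch_log k) + ln (10 / alpha).

Lemma epoch_level_gt0 alpha k : 0 < alpha < 1 -> 0 < epoch_level alpha k.
Proof.
move=> /andP[a0 a1].
have h1 : - (3 / 7) <= ln (epoch_log k).
  have := ln_ge1BV (epoch_log_gt0 k).
  suff : (epoch_log k)^-1 <= 10 / 7 by lra.
  rewrite -[leRHS]invrK lef_pV2 ?posrE ?epoch_log_gt0//.
  by rewrite /epoch_log invf_div lerDl mulr_ge0.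
have h2 : 9 / 10 <= ln (10 / alpha).
  have p10 : 0 < 10 / alpha by rewrite divr_gt0.
  by have := ln_ge1BV p10; rewrite invf_div; lra.
by rewrite /epoch_level; lra.
Qed.

Lemma epoch_level_le alpha k (t : nat) : (4 ^ k <= t)%N ->
  epoch_level alpha k <= 14 / 10 * ln (ln (21 / 10 * t%:R)) + ln (10 / alpha).
Proof.
move=> kt; have h := epoch_log_le kt.
rewrite lerD2r ler_wpM2l// ler_ln ?posrE ?epoch_log_gt0//.
exact: lt_le_trans (epoch_log_gt0 k) h.
Qed.

Lemma stitched_radius_ge0 alpha (t : nat) x : 0 < alpha < 1 -> (0 < t)%N ->
  0 <= stitched_radius alpha t x.
Proof.
move=> a01 t0; have t1 : (4 ^ 0 <= t)%N by [].
have L0 := le_trans (ltW (epoch_level_gt0 0 a01)) (epoch_level_le alpha t1).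
by rewrite /stitched_radius /ell addr_ge0 ?mulr_ge0 ?sqrtr_ge0 ?divr_ge0.
Qed.

End stitching.

Section stitched_bound.
Context {d : measure_display} {Omega : measurableType d} {R : realType}.
Variable P : probability Omega R.
Context {T : finType}.
Implicit Types (Z : nat -> Omega -> T) (mu phi : T -> R) (x alpha : R).

(** Union bound over the epochs, each with its own line. *)
Lemma stitched_one_sided Z mu phi x alpha : iid_letters P Z mu ->
  mean_letter mu phi x -> 0 < x < 1 -> 0 < alpha < 1 ->
  (P [set w | exists t, (0 < t)%N /\
     (t%:R * (x + stitched_radius alpha t x) <= letter_sum phi (word Z t w))%R]
   <= (alpha / 2)%:E)%E.
Proof.
move=> hZ hphi /andP[x0 x1] /andP[a0 a1].
pose v := x * (1 - x).
have v0 : 0 < v by rewrite mulr_gt0 ?subr_gt0.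
pose l := epoch_level alpha.
have l0 k : 0 < l k by rewrite epoch_level_gt0// a0.
pose r k := Num.sqrt (v * 4 ^+ k / l k).
pose lam k := (3^-1 + r k)^-1.
have r0 k : 0 < r k by rewrite sqrtr_gt0 divr_gt0// mulr_gt0// exprn_gt0.
have lam03 k : 0 <= lam k < 3.
  rewrite invr_ge0 addr_ge0 ?(ltW (r0 k))//=.
  by rewrite -[ltRHS]invrK ltf_pV2 ?posrE ?addr_gt0// ltrDl.
pose psi k := v * (lam k ^+ 2 / (2 * (1 - lam k / 3))).
pose A k := [set w | exists t, l k <= lam k * (letter_sum phi (word Z t w) - t%:R * x)
   - t%:R * psi k].
have mA k : measurable (A k).
  exact: (measurable_word_ex (fun t s => l k <= lam k * (letter_sum phi s - t%:R * x)
   - t%:R * psi k) hZ.1).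
have PA k : (P (A k) <= (expR (- l k))%:E)%E.
  by apply: (chernoff_line _ hZ hphi); apply: (bernstein_mgf hphi) => //; rewrite !ltW.
have sub : [set w | exists t, (0 < t)%N /\
     t%:R * (x + stitched_radius alpha t x) <= letter_sum phi (word Z t w)]
   `<=` \bigcup_k A k.
  move=> w [t [t0 St]].
  have [kt tk] : (4 ^ trunc_log 4 t <= t)%N /\ (t < 4 ^ (trunc_log 4 t).+1)%N.
    by split; [apply: trunc_logP|apply: trunc_log_ltn].
  move: (trunc_log 4 t) kt tk => k kt tk.
  exists k => //; exists t.
  have t0R : 0 < t%:R :> R by rewrite ltr0n.
  have n0 : 0 < 4 ^+ k :> R by rewrite exprn_gt0.
  pose L := 14 / 10 * ln (ln (21 / 10 * t%:R)) + ln (10 / alpha).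
  have lL : l k <= L by exact: epoch_level_le.
  apply: (@epoch_line _ v (4 ^+ k) t%:R (l k) L) => //.
  - rewrite -natrX ler_nat kt/= -natrM ler_nat ltnW//.
    by rewrite -expnS.
  - by rewrite l0.
  move: St; rewrite mulrDr -lerBrDl; apply: le_trans.
  rewrite /stitched_radius /ell -/L [leRHS]mulrDr lerD//; last first.
    by rewrite mulrCA [t%:R * _]mulrC divfK ?gt_eqF.
  rewrite [leRHS]mulrCA ler_wpM2l// -[X in _ <= X * _](ger0_norm (ltW t0R)).
  rewrite -sqrtr_sqr -sqrtrM ?sqr_ge0//.
  rewrite ler_wsqrtr// [leRHS](_ : _ = v * (t%:R * L))// -/v.
  by field; rewrite gt_eqF.
have mX : measurable [set w | exists t, (0 < t)%N /\
     t%:R * (x + stitched_radius alpha t x) <= letter_sum phi (word Z t w)].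
  exact: (measurable_word_ex (fun t s => (0 < t)%N /\
    t%:R * (x + stitched_radius alpha t x) <= letter_sum phi s) hZ.1).
apply: (le_trans (measure_sigma_subadditive _ mA mX sub)).
apply: lime_le; first by apply: is_cvg_nneseries => *; exact: measure_ge0.
apply: nearW => n.
apply: (@le_trans _ _ (\sum_(0 <= k < n) (expR (- l k))%:E)%E).
  by apply: lee_sum => k _; exact: PA.
rewrite sumEFin lee_fin big_mkord.
rewrite /l /epoch_level.
under eq_bigr do
  rewrite opprD expRD expRN [in X in _ * X]expRN lnK ?posrE ?divr_gt0// -expRN invf_div.
have a10 : 0 <= alpha / 10 by rewrite divr_ge0// ltW.
by rewrite -mulr_suml; have := ler_wpM2r a10 (@epoch_weights_sum R n); lra.
Qed.

End stitched_bound.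

(** * The beta integral *)

Section beta_integral.
Context {R : realType}.
Implicit Types (a b e u x y : R) (f F h : R -> R) (n : nat).
Let mu := @lebesgue_measure R.
Let D : set R := `]0%R, 1%R[%classic.

Definition beta_weight a b u : R := u `^ (a - 1) * (1 - u) `^ (b - 1).

(** Closed intervals exhausting the open unit interval, symmetric around [1 / 2] so that the
    substitution [u |-> 1 - u] preserves them; the offset 3 keeps them
    nondegenerate. On them the beta weight is continuous, whereas it may blow
    up at 0 and at 1. *)
Definition inner_itv n : set R := `[(n.+3%:R)^-1, 1 - (n.+3%:R)^-1]%classic.

Lemma inner_itv_sub n : inner_itv n `<=` D.
Proof.
move=> u; rewrite /inner_itv /D/= !in_itv/= => /andP[nu un].
have n0 : 0 < (n.+3%:R : R)^-1 by rewrite invr_gt0.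
by rewrite (lt_le_trans n0)//= (le_lt_trans un)// ltrBlDr ltrDl.
Qed.

Lemma bigcup_inner_itv : \bigcup_n inner_itv n = D.
Proof.
apply/seteqP; split => [u [n _]|u]; first exact: inner_itv_sub.
rewrite /D/= in_itv/= => /andP[u0 u1].
pose m := Num.min u (1 - u).
have m0 : 0 < m by rewrite lt_min u0 subr_gt0.
exists (Num.truncn m^-1) => //.
have nm : ((Num.truncn m^-1).+3%:R)^-1 <= m.
  rewrite -[leRHS]invrK lef_pV2 ?posrE ?invr_gt0//.
  have := truncnS_gt m^-1; move/ltW/le_trans; apply; by rewrite ler_nat; exact: (leq_addl 2).
rewrite /inner_itv/= in_itv/=; apply/andP; split.
  by apply: (le_trans nm); rewrite ge_min lexx.
rewrite lerBrDr addrC -lerBrDr; apply: (le_trans nm).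
by rewrite ge_min lexx orbT.
Qed.

Lemma inner_itv_nondecreasing : nondecreasing_seq inner_itv.
Proof.
move=> m n mn; apply/subsetPset => u; rewrite /inner_itv/= !in_itv/= => /andP[mu' um].
have nm : (n.+3%:R : R)^-1 <= (m.+3%:R)^-1 by rewrite lef_pV2 ?posrE// ler_nat.
by rewrite (le_trans nm)//= (le_trans um)// lerB.
Qed.

Lemma inner_itv_lt n : (n.+3%:R : R)^-1 < 1 - (n.+3%:R)^-1.
Proof.
have : (n.+3%:R : R)^-1 <= 3^-1 by rewrite lef_pV2 ?posrE// ler_nat.
by move: (_^-1) => e; lra.
Qed.

Lemma ge0_integral_inner_itv_cvg f : measurable_fun [set: R] f ->
  (forall u, D u -> 0 <= f u) ->
  (\int[mu]_(u in inner_itv n) (f u)%:E @[n --> \oo] --> \int[mu]_(u in D) (f u)%:E)%E.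
Proof.
move=> mf f0; rewrite -bigcup_inner_itv.
apply: ge0_nondecreasing_set_cvg_integral.
- exact: inner_itv_nondecreasing.
- by move=> n; exact: measurable_itv.
- by move=> n; apply/measurable_EFinP; apply: measurable_funS mf.
- by move=> n u /inner_itv_sub Du; rewrite lee_fin f0.
Qed.

(** The fundamental theorem of calculus bounds the integral on each
    [inner_itv n] by the oscillation of the primitive [F]. *)
Lemma ge0_integrable_oo f F (M : R) : measurable_fun [set: R] f ->
  (forall u, D u -> 0 <= f u) -> (forall u, D u -> {for u, continuous f}) ->
  (forall u, D u -> is_derive u 1 F (f u)) -> (forall u, D u -> `|F u| <= M) ->
  mu.-integrable D (EFin \o f).
Proof.
move=> mf f0 cf dF FM; apply/integrableP; split.
  by apply/measurable_EFinP; apply: measurable_funS mf.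
under eq_integral => u /set_mem Du do rewrite /= ger0_norm ?f0//.
apply: (@le_lt_trans _ _ (M + M)%:E); last exact: ltry.
have cvgI := ge0_integral_inner_itv_cvg mf f0.
rewrite -(cvg_lim _ cvgI)//; apply: lime_le.
  by apply/cvg_ex; eexists; exact: cvgI.
apply: nearW => n.
have cF u : D u -> {for u, continuous F}.
  by move=> Du; apply/differentiable_continuous/derivable1_diffP; case: (dF u Du).
have lD : D (n.+3%:R)^-1.
  by apply: (@inner_itv_sub n); rewrite /inner_itv/= in_itv/= lexx ltW// inner_itv_lt.
have rD : D (1 - (n.+3%:R)^-1).
  by apply: (@inner_itv_sub n); rewrite /inner_itv/= in_itv/= lexx ltW// inner_itv_lt.
rewrite (@continuous_FTC2 _ f F) ?inner_itv_lt//.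
- rewrite -EFinB lee_fin lerD//; first exact: le_trans (ler_norm _) (FM _ rD).
  by apply: le_trans (ler_norm _) _; rewrite normrN FM.
- apply: continuous_in_subspaceT => u /set_mem/inner_itv_sub; exact: cf.
- split.
  + move=> u /subset_itv_oo_cc/inner_itv_sub Du; exact: (@ex_derive _ _ _ _ _ _ _ (dF u Du)).
  + by apply: cvg_at_right_filter; exact: cF.
  + by apply: cvg_at_left_filter; exact: cF.
- move=> u /subset_itv_oo_cc/inner_itv_sub Du; rewrite derive1E.
  exact: (@derive_val _ _ _ _ _ _ _ (dF u Du)).
Qed.

Lemma continuous_powRl x y : 0 < x -> {for x, continuous (fun z : R => z `^ y)}.
Proof.
move=> x0; apply/differentiable_continuous/derivable1_diffP.
exact: (@ex_derive _ _ _ _ _ _ _ (is_derive1_powR y x0)).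
Qed.

Lemma continuous_powR1Bl x y : x < 1 -> {for x, continuous (fun z : R => (1 - z) `^ y)}.
Proof.
move=> x1; apply: (@continuous_comp _ _ _ (fun z : R => 1 - z) (fun z : R => z `^ y)).
  by apply: continuousB => //; exact: cst_continuous.
by apply: continuous_powRl; rewrite subr_gt0.
Qed.

Lemma measurable_powR1B y : measurable_fun [set: R] (fun u => (1 - u) `^ y).
Proof.
apply: (measurableT_comp (measurable_powR y) (g := fun u : R => 1 - u)).
by apply: measurable_funB => //; exact: measurable_cst.
Qed.

Lemma continuous_beta_weight a b u : D u -> {for u, continuous (beta_weight a b)}.
Proof.
rewrite /D/= in_itv/= => /andP[u0 u1].
exact: (@continuousM _ _ (fun z : R => z `^ (a - 1)) (fun z : R => (1 - z) `^ (b - 1)) u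
  (continuous_powRl u0) (continuous_powR1Bl u1)).
Qed.

Lemma measurable_beta_weight a b : measurable_fun [set: R] (beta_weight a b).
Proof. by apply: measurable_funM => //; exact: measurable_powR1B. Qed.

Lemma beta_weight_ge0 a b u : 0 <= beta_weight a b u.
Proof. by rewrite mulr_ge0 ?powR_ge0. Qed.

Lemma powR_le1 x y : 0 <= x <= 1 -> 0 <= y -> x `^ y <= 1.
Proof.
move=> /andP[x0 x1] y0.
by have := @ge0_ler_powR _ y y0 x 1; rewrite powR1 !nnegrE => ->.
Qed.

(** Writing [1 = u + (1 - u)] splits the weight into two terms, dominated by
    [(1 - u) `^ (b - 1)] and [u `^ (a - 1)], whose primitives are bounded. *)
Lemma integrable_beta_weight a b : 0 < a -> 0 < b ->
  mu.-integrable D (EFin \o beta_weight a b).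
Proof.
move=> a0 b0.
pose f u := u `^ (a - 1) + (1 - u) `^ (b - 1).
pose F u := a^-1 * u `^ a - b^-1 * (1 - u) `^ b.
have fi : mu.-integrable D (EFin \o f).
  apply: (@ge0_integrable_oo f F (a^-1 + b^-1)).
  - by apply: measurable_funD => //; exact: measurable_powR1B.
  - by move=> u _; rewrite addr_ge0 ?powR_ge0.
  - move=> u; rewrite /D/= in_itv/= => /andP[u0 u1].
    by apply: continuousD; [exact: continuous_powRl|exact: continuous_powR1Bl].
  - move=> u; rewrite /D/= in_itv/= => /andP[u0 u1].
    have u10 : 0 < 1 - u by rewrite subr_gt0.
    have d1 := is_derive1_powR a u0.
    have d2 : is_derive u 1 (fun z : R => (1 - z) `^ b) (- (b * (1 - u) `^ (b - 1))).
      have d4 : is_derive u 1 (fun z : R => 1 - z) (-1).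
        by apply: is_derive_eq; ring.
      have := @is_derive1_comp _ (fun z : R => z `^ b) (fun z : R => 1 - z) u _ _
        (is_derive1_powR b u10) d4.
      by rewrite mulrN1.
    rewrite /F; apply: is_derive_eq; rewrite /GRing.scale/= /f.
    by field; rewrite !gt_eqF.
  - move=> u; rewrite /D/= in_itv/= => /andP[u0 u1].
    rewrite /F (le_trans (ler_normB _ _))// lerD// ger0_norm ?mulr_ge0 ?powR_ge0//
      ?invr_ge0 ?(ltW a0) ?(ltW b0)//.
      by rewrite ler_piMr ?invr_ge0 ?(ltW a0)// powR_le1 ?(ltW a0)// !ltW.
    rewrite ler_piMr ?invr_ge0 ?(ltW b0)// powR_le1 ?(ltW b0)//.
    by rewrite subr_ge0 gerBl !ltW.
apply: (le_integrable _ _ _ fi); first exact: measurable_itv.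
  by apply/measurable_EFinP; apply: measurable_funS (measurable_beta_weight a b).
move=> u; rewrite /D/= in_itv/= => /andP[u0 u1].
rewrite lee_fin !ger0_norm ?beta_weight_ge0 ?addr_ge0 ?powR_ge0//.
have u10 : 0 < 1 - u by rewrite subr_gt0.
have -> : beta_weight a b u = u `^ a * (1 - u) `^ (b - 1) + u `^ (a - 1) * (1 - u) `^ b.
  rewrite -(mulr_powRB1 (ltW u0) a0) -(mulr_powRB1 (ltW u10) b0) /beta_weight; ring.
rewrite addrC lerD//.
  by rewrite ler_piMr ?powR_ge0// powR_le1 ?(ltW b0)// gerBl !ltW.
by rewrite ler_piMl ?powR_ge0// powR_le1 ?(ltW a0)// !ltW.
Qed.

End beta_integral.

Section beta_function.
Context {R : realType}.
Implicit Types (a b u x y s : R) (f F h : R -> R) (n : nat).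
Let mu := @lebesgue_measure R.
Let D : set R := `]0%R, 1%R[%classic.

Lemma beta_real_oo a b : beta_real a b = \int[mu]_(u in D) beta_weight a b u.
Proof.
have mw (A : set R) : measurable_fun A (EFin \o beta_weight a b).
  by apply/measurable_EFinP; apply: measurable_funS (measurable_beta_weight a b).
rewrite /beta_real /Rintegral -integral_itv_obnd_cbnd; last exact: mw.
by rewrite -integral_itv_bndo_bndc; last exact: mw.
Qed.

Lemma beta_realC a b : beta_real a b = beta_real b a.
Proof.
rewrite !beta_real_oo /Rintegral; congr fine.
have h a' b' := ge0_integral_inner_itv_cvg (measurable_beta_weight a' b')
  (fun u _ => beta_weight_ge0 a' b' u).
apply/esym/(cvg_unique (@ereal_hausdorff R) (h b a)).
apply: cvg_trans (h a b); apply: near_eq_cvg; apply: nearW => n.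
rewrite /inner_itv; set e := (n.+3%:R)^-1.
have e0 : 0 < e by rewrite invr_gt0.
have e1 : e < 1 - e by exact: inner_itv_lt.
pose F x : R := 1 - x.
have F' : F^`()%classic = cst (-1).
  by apply/funext => x; rewrite derive1E deriveB// derive_id derive_cst sub0r.
have := @integration_by_substitution_decreasing R F (beta_weight a b) e (1 - e).
have -> : F (1 - e) = e by rewrite /F; ring.
rewrite -/(F e) F' => ->.
- by apply: eq_integral => u _; rewrite /= !fctE /beta_weight /F opprK mulr1 subKr mulrC.
- exact: ltW.
- by move=> x y _ _ xy; rewrite /F ler_ltB.
- by move=> ? ?; exact: cvg_cst.
- exact: is_cvg_cst.
- exact: is_cvg_cst.
- split => /=.
  + by move=> x _; exact: derivableB.
  + by apply: cvg_at_right_filter; apply: cvgB => //; exact: cvg_cst.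
  + by apply: cvg_at_left_filter; apply: cvgB => //; exact: cvg_cst.
- apply: continuous_in_subspaceT => u /set_mem/inner_itv_sub.
  exact: continuous_beta_weight.
Qed.

Lemma beta_real_gt0 a b : 0 < a -> 0 < b -> 0 < beta_real a b.
Proof.
move=> a0 b0; rewrite beta_real_oo.
have iw := integrable_beta_weight a0 b0.
rewrite lt_neqAle eq_sym Rintegral_ge0 ?andbT; last by move=> u _; exact: beta_weight_ge0.
apply/eqP => w0.
have : (\int[mu]_(u in D) `|(EFin \o beta_weight a b) u| = 0)%E.
  under eq_integral => u _ do rewrite /= ger0_norm ?beta_weight_ge0//.
  by rewrite -(fineK (integrable_fin_num _ iw)) ?[fine _]w0//; exact: measurable_itv.
have mw : measurable_fun D (EFin \o beta_weight a b) by case/integrableP : iw.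
move=> /(ae_eq_integral_abs mu (measurable_itv _) mw) [N [mN N0 DN]].
have : (mu D <= mu N)%E.
  apply: le_measure; rewrite ?inE//; first exact: measurable_itv.
  move=> u Du; apply: DN => /= /(_ Du) [].
  move: Du; rewrite /D/= in_itv/= => /andP[u0 u1].
  by apply/eqP; rewrite gt_eqF// mulr_gt0// powR_gt0// subr_gt0.
by rewrite (N0 : mu N = 0%E) /mu /D lebesgue_measure_itv/= lte_fin ltr01 oppr0 adde0 lee_fin ler10.
Qed.

Lemma integrable_scale (c : R) f : mu.-integrable D (EFin \o f) ->
  mu.-integrable D (EFin \o (fun u => c * f u)).
Proof.
move=> fi; suff : mu.-integrable D (fun u => c%:E * (EFin \o f) u)%E by [].
by apply: integrableZl => //; exact: measurable_itv.
Qed.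

Lemma integrable_beta_weightM a b h : 0 < a -> 0 < b -> continuous h ->
  mu.-integrable D (EFin \o (fun u => beta_weight a b u * h u)).
Proof.
move=> a0 b0 ch.
have [c _ hc] : exists2 c, c \in `[0%R, 1%R] & forall t, t \in `[0%R, 1%R] -> `|h t| <= `|h c|.
  apply: (@EVT_max R (fun t => `|h t|)) => //; apply: continuous_subspaceT => u.
  by apply: cvg_norm; exact: ch.
have iZ := integrable_scale `|h c| (integrable_beta_weight a0 b0).
apply: (le_integrable _ _ _ iZ); first exact: measurable_itv.
  apply/measurable_EFinP; apply: measurable_funM.
    by apply: measurable_funS (measurable_beta_weight a b).
  by apply: measurable_funS (continuous_measurable_fun ch).
move=> u Du; rewrite /= lee_fin !normrM normr_id mulrC ler_wpM2r// hc//.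
exact: subset_itv_oo_cc Du.
Qed.

End beta_function.

(** * The beta mixture martingale *)

Section mixture.
Context {R : realType}.
Implicit Types (a b c u x y s v r th alpha : R) (f F h : R -> R) (n : nat).
Let mu := @lebesgue_measure R.
Let D : set R := `]0%R, 1%R[%classic.

Definition mixture_kernel x r s v u : R :=
  (x `^ (v / (1 - x) + s) * (1 - x) `^ (v / x - s))^-1 *
  beta_weight ((r + v) / x - s) ((r + v) / (1 - x) + s) u.

Definition mixture_exponent x r s v u : R :=
  - ((v / (1 - x) + s) * ln x) - (v / x - s) * ln (1 - x)
  + ((r + v) / x - s - 1) * ln u + ((r + v) / (1 - x) + s - 1) * ln (1 - u).

Lemma powR_expR x y : 0 < x -> x `^ y = expR (y * ln x).
Proof. by move=> x0; rewrite /powR gt_eqF. Qed.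

Lemma mixture_kernelE x r s v u : 0 < x < 1 -> D u ->
  mixture_kernel x r s v u = expR (mixture_exponent x r s v u).
Proof.
move=> /andP[x0 x1]; rewrite /D/= in_itv/= => /andP[u0 u1].
rewrite /mixture_kernel /beta_weight !powR_expR ?subr_gt0// -expRD -expRN -!expRD.
by congr expR; rewrite /mixture_exponent; ring.
Qed.

Lemma integrable_mixture_kernel x r s v :
  0 < (r + v) / x - s -> 0 < (r + v) / (1 - x) + s ->
  mu.-integrable D (EFin \o mixture_kernel x r s v).
Proof.
by move=> a0 b0; apply: integrable_scale; exact: integrable_beta_weight.
Qed.

(** The parameter [s] enters the mixture through the exponent of the integrand
    only, and [mixture_exponent] is affine in [s]: hence the convexity below. *)
Lemma beta_mixtureE x r s v :
  0 < (r + v) / x - s -> 0 < (r + v) / (1 - x) + s ->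
  beta_mixture x r s v =
  (beta_real (r / x) (r / (1 - x)))^-1 * \int[mu]_(u in D) mixture_kernel x r s v u.
Proof.
move=> a0 b0; rewrite /beta_mixture [X in _ * (X / _)]beta_real_oo /mixture_kernel.
rewrite RintegralZl; [|exact: measurable_itv|].
  by move: (_^-1) (_^-1) (Rintegral _ _ _) => p q z; ring.
exact: integrable_beta_weight.
Qed.

(** Exchange of heads and tails: the substitution [u |-> 1 - u]. *)
Lemma beta_mixtureC x r s v : beta_mixture (1 - x) r (- s) v = beta_mixture x r s v.
Proof.
rewrite /beta_mixture subKr opprK [beta_real _ _ in LHS]beta_realC.
by rewrite [X in _ * (_ / X)]beta_realC [X in X^-1 * _]mulrC.
Qed.

Lemma beta_mixture_ge0 x r s v : 0 < x < 1 -> 0 < r ->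
  0 < (r + v) / x - s -> 0 < (r + v) / (1 - x) + s ->
  0 <= beta_mixture x r s v.
Proof.
move=> /andP[x0 x1] r0 a0 b0; rewrite /beta_mixture.
rewrite mulr_ge0 ?invr_ge0 ?mulr_ge0 ?powR_ge0// ltW// ?invr_gt0 beta_real_gt0//;
  by rewrite divr_gt0// subr_gt0.
Qed.

Lemma beta_mixture_convex x r v s1 s2 th : 0 < x < 1 -> 0 < r -> 0 <= th <= 1 ->
  0 < (r + v) / x - s1 -> 0 < (r + v) / (1 - x) + s1 ->
  0 < (r + v) / x - s2 -> 0 < (r + v) / (1 - x) + s2 ->
  beta_mixture x r (th * s1 + (1 - th) * s2) v <=
  th * beta_mixture x r s1 v + (1 - th) * beta_mixture x r s2 v.
Proof.
move=> x01 r0 th01 a1 b1 a2 b2.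
have /andP[x0 x1] := x01; have /andP[th0 th1] := th01.
have th1' : 0 <= 1 - th by rewrite subr_ge0.
have a3 : 0 < (r + v) / x - (th * s1 + (1 - th) * s2).
  move: a1 a2; move: (_ / x) => A a1 a2.
  have [->|th0'] := eqVneq th 0; first by lra.
  have h1 : 0 < th * (A - s1) by rewrite mulr_gt0// lt_neqAle eq_sym th0'.
  have h2 : 0 <= (1 - th) * (A - s2) by rewrite mulr_ge0// ltW.
  lra.
have b3 : 0 < (r + v) / (1 - x) + (th * s1 + (1 - th) * s2).
  move: b1 b2; move: (_ / (1 - x)) => A b1 b2.
  have [->|th0'] := eqVneq th 0; first by lra.
  have h1 : 0 < th * (A + s1) by rewrite mulr_gt0// lt_neqAle eq_sym th0'.
  have h2 : 0 <= (1 - th) * (A + s2) by rewrite mulr_ge0// ltW.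
  lra.
rewrite !beta_mixtureE// [X in _ <= X + _]mulrCA [X in _ <= _ + X]mulrCA -mulrDr ler_wpM2l//.
  by rewrite invr_ge0 ltW// beta_real_gt0// divr_gt0// subr_gt0.
have i1 := integrable_mixture_kernel a1 b1.
have i2 := integrable_mixture_kernel a2 b2.
have i3 := integrable_mixture_kernel a3 b3.
rewrite -RintegralZl; [|exact: measurable_itv|exact: i1].
rewrite -RintegralZl; [|exact: measurable_itv|exact: i2].
rewrite -RintegralD; [|exact: measurable_itv|exact: integrable_scale|exact: integrable_scale].
apply: le_Rintegral; [exact: measurable_itv|exact: i3| |].
  have : mu.-integrable D (fun u => (EFin \o (fun u => th * mixture_kernel x r s1 v u)%R) u +
      (EFin \o (fun u => (1 - th) * mixture_kernel x r s2 v u)%R) u)%E.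
    by apply: integrableD; [exact: measurable_itv|exact: integrable_scale|exact: integrable_scale].
  by [].
move=> u Du; rewrite !mixture_kernelE//.
apply: le_trans (exp_chord _ _ th01); rewrite ler_expR.
by rewrite /mixture_exponent le_eqVlt; apply/orP; left; apply/eqP; ring.
Qed.

(** A finite convex function of [s] that is below [c] at some point stays below
    [c] a little further to the right. *)
Lemma beta_mixture_lt_right x r v s c : 0 < x < 1 -> 0 < r -> 0 <= v ->
  0 <= s < (r + v) / x -> beta_mixture x r s v < c ->
  exists2 s', s < s' < (r + v) / x & beta_mixture x r s' v < c.
Proof.
move=> x01 r0 v0 /andP[s0 sm] Mc; have /andP[x0 x1] := x01.
set sm' := (r + v) / x; pose s1 := (s + sm') / 2.
have b0 y : 0 <= y -> 0 < (r + v) / (1 - x) + y.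
  by move=> y0; rewrite ltr_wpDr// divr_gt0 ?subr_gt0// ltr_wpDr.
have s1m : s < s1 < sm' by rewrite /s1; apply/andP; split; move: sm; rewrite -/sm'; lra.
have /andP[ss1 s1sm] := s1m.
have a1 : 0 < sm' - s1 by rewrite subr_gt0.
have a0 : 0 < sm' - s by rewrite subr_gt0.
have s10 : 0 <= s1 by rewrite (le_trans s0)// ltW.
have M0 := beta_mixture_ge0 x01 r0 a0 (b0 _ s0).
have M1 := beta_mixture_ge0 x01 r0 a1 (b0 _ s10).
pose de := c - beta_mixture x r s v.
have de0 : 0 < de by rewrite subr_gt0.
pose th := de / (de + beta_mixture x r s1 v).
have q0 : 0 < de + beta_mixture x r s1 v by rewrite ltr_wpDr.
have th0 : 0 < th by rewrite divr_gt0.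
have th1 : th <= 1 by rewrite ler_pdivrMr// mul1r lerDl.
exists (th * s1 + (1 - th) * s).
  have h1 : 0 < th * (s1 - s) by rewrite mulr_gt0// subr_gt0.
  have h2 : 0 <= (1 - th) * (s1 - s) by rewrite mulr_ge0 ?subr_ge0// ltW.
  by apply/andP; split; lra.
have th01 : 0 <= th <= 1 by rewrite th1 ltW.
apply: (le_lt_trans (beta_mixture_convex x01 r0 th01 a1 (b0 _ s10) a0 (b0 _ s0))).
have h : th * beta_mixture x r s1 v < de.
  rewrite /th mulrAC ltr_pdivrMr// ltr_pM2l// ltrDr//.
have : 0 <= th * beta_mixture x r s v by rewrite mulr_ge0// ltW.
by rewrite /de in h *; lra.
Qed.

Lemma mixture_radius_ge0 alpha r (t : nat) x : 0 <= mixture_radius alpha r t x.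
Proof.
rewrite mulr_ge0 ?invr_ge0//; set A := [set _ | _].
have [hA|nA] := pselect (has_sup A); last by rewrite sup_out.
have [s As] := hA.1; apply: le_trans (ub_le_sup hA.2 As).
by case: As => /andP[].
Qed.

(** Were the mixture below [alpha^-1] at [s], it would still be so at some
    [s' > s], which would contradict the definition of the radius as a
    supremum. *)
Lemma mixture_radius_le alpha r (t : nat) x s : 0 < x < 1 -> 0 < r -> (0 < t)%N ->
  s < (r + x * (1 - x) * t%:R) / x -> t%:R * mixture_radius alpha r t x <= s ->
  alpha^-1 <= beta_mixture x r s (x * (1 - x) * t%:R).
Proof.
move=> x01 r0 t0 sm rs; rewrite leNgt; apply/negP => Mlt.
have /andP[x0 x1] := x01.
have s0 : 0 <= s by rewrite (le_trans _ rs)// mulr_ge0// mixture_radius_ge0.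
have v0 : 0 <= x * (1 - x) * t%:R by rewrite !mulr_ge0 ?subr_ge0// ltW.
have [|s' /andP[ss' s'm] Ms'] := beta_mixture_lt_right x01 r0 v0 _ Mlt.
  by rewrite s0.
move: rs; rewrite /mixture_radius mulrA divff ?mul1r ?pnatr_eq0 -?lt0n//.
rewrite leNgt => /negP; apply; apply: (lt_le_trans ss').
apply: ub_le_sup; last by split => //; rewrite s'm (le_trans s0)// ltW.
by exists ((r + x * (1 - x) * t%:R) / x) => y [/andP[_ /ltW]].
Qed.

End mixture.

Section mixture_martingale.
Context {d : measure_display} {Omega : measurableType d} {R : realType}.
Variable P : probability Omega R.
Context {T : finType}.
Implicit Types (Z : nat -> Omega -> T) (mu phi : T -> R) (x r u alpha : R).
Let leb := @lebesgue_measure R.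
Let D : set R := `]0%R, 1%R[%classic.

(** For letters valued in {0, 1} this is the likelihood ratio of coin tosses of
    success probability [1 - u] against [x]; a letter valued in between
    contributes the average over its two possible outcomes. *)
Definition likelihood phi x (s : seq T) u : R :=
  \prod_(a <- s) (phi a * ((1 - u) / x) + (1 - phi a) * (u / (1 - x))).

Definition mixture_martingale phi x r (s : seq T) : R :=
  (beta_real (r / x) (r / (1 - x)))^-1 *
  \int[leb]_(u in D) (beta_weight (r / x) (r / (1 - x)) u * likelihood phi x s u).

Lemma likelihood_rcons phi x s a u : likelihood phi x (rcons s a) u =
  likelihood phi x s u * (phi a * ((1 - u) / x) + (1 - phi a) * (u / (1 - x))).
Proof. by rewrite /likelihood -cats1 big_cat big_seq1. Qed.

Lemma continuous_mulr_fun (f g : R -> R) :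
  continuous f -> continuous g -> continuous (fun u => f u * g u).
Proof. by move=> cf cg u; exact: (continuousM (cf u) (cg u)). Qed.

Lemma continuous_1B : continuous (fun u : R => 1 - u).
Proof. by move=> u; apply: cvgB; [exact: cvg_cst|exact: cvg_id]. Qed.

Lemma continuous_likelihood phi x s : continuous (likelihood phi x s).
Proof.
elim/last_ind: s => [|s a IH].
  rewrite /likelihood; under eq_fun do rewrite big_nil.
  exact: cst_continuous.
rewrite (_ : likelihood _ _ _ = fun u => likelihood phi x s u *
    (phi a * ((1 - u) / x) + (1 - phi a) * (u / (1 - x)))); last first.
  by apply/funext => u; rewrite likelihood_rcons.
apply: continuous_mulr_fun => // u.
apply: cvgD.
  apply: cvgMr; apply: cvgMl; exact: continuous_1B.
apply: cvgMr; apply: cvgMl; exact: cvg_id.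
Qed.

Lemma likelihood_ge0 phi x s u : (forall a, 0 <= phi a <= 1) -> 0 < x < 1 ->
  D u -> 0 <= likelihood phi x s u.
Proof.
move=> phi01 /andP[x0 x1]; rewrite /D/= in_itv/= => /andP[u0 u1].
rewrite prodr_ge0// => a _; have /andP[p0 p1] := phi01 a.
by rewrite addr_ge0// mulr_ge0 ?divr_ge0 ?subr_ge0// ltW.
Qed.

(** The factor of one more letter has mean [(1 - u) + u = 1], for each [u]. *)
Lemma mixture_martingaleP mu phi x r s : mean_letter mu phi x ->
  0 < x < 1 -> 0 < r ->
  \sum_a mu a * mixture_martingale phi x r (rcons s a) =
  mixture_martingale phi x r s.
Proof.
move=> [mu0 mu1 phi01 muphi] /andP[x0 x1] r0.
have a0 : 0 < r / x by rewrite divr_gt0.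
have b0 : 0 < r / (1 - x) by rewrite divr_gt0// subr_gt0.
pose w := beta_weight (r / x) (r / (1 - x)).
pose L := likelihood phi x s.
have mD : measurable (D : set (measurableTypeR R)) by exact: measurable_itv.
have iL1 : leb.-integrable D (EFin \o (fun u => w u * (L u * (1 - u)))).
  apply: integrable_beta_weightM => //; apply: continuous_mulr_fun.
    exact: continuous_likelihood.
  exact: continuous_1B.
have iL2 : leb.-integrable D (EFin \o (fun u => w u * (L u * u))).
  apply: integrable_beta_weightM => //; apply: continuous_mulr_fun.
    exact: continuous_likelihood.
  by move=> u; exact: cvg_id.
pose J1 := \int[leb]_(u in D) (w u * (L u * (1 - u))).
pose J2 := \int[leb]_(u in D) (w u * (L u * u)).
have Ms a : mixture_martingale phi x r (rcons s a) =
    (beta_real (r / x) (r / (1 - x)))^-1 * (phi a / x * J1 + (1 - phi a) / (1 - x) * J2).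
  congr (_ * _).
  rewrite -RintegralZl// -RintegralZl// -RintegralD//;
    [|exact: integrable_scale|exact: integrable_scale].
  apply: eq_Rintegral => u _; rewrite likelihood_rcons -/w -/(L u).
  by move: (x^-1) ((1 - x)^-1) => p q; ring.
have -> : mixture_martingale phi x r s = (beta_real (r / x) (r / (1 - x)))^-1 * (J1 + J2).
  congr (_ * _); rewrite -RintegralD//.
  by apply: eq_Rintegral => u _; rewrite -/w -/(L u); ring.
under eq_bigr do rewrite Ms mulrCA.
rewrite -mulr_sumr; congr (_ * _).
transitivity (\sum_a (mu a * phi a * (x^-1 * J1) + (mu a - mu a * phi a) * ((1 - x)^-1 * J2))).
  by apply: eq_bigr => a _; move: (x^-1) ((1 - x)^-1) => p q; ring.
rewrite big_split/= -!mulr_suml sumrB muphi mu1 !mulrA !divff ?mul1r// gt_eqF//.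
by rewrite subr_gt0.
Qed.

(** Letter by letter, the weighted geometric mean of the two likelihood ratios
    is at most their weighted arithmetic mean; the products of the geometric
    means integrate to the mixture, for a real number of successes. *)
Lemma beta_mixture_le_martingale phi x r s :
  (forall a, 0 <= phi a <= 1) -> 0 < x < 1 -> 0 < r ->
  beta_mixture x r (letter_sum phi s - (size s)%:R * x) (x * (1 - x) * (size s)%:R)
  <= mixture_martingale phi x r s.
Proof.
move=> phi01 x01 r0; have /andP[x0 x1] := x01.
have x10 : 0 < 1 - x by rewrite subr_gt0.
set v := x * (1 - x) * (size s)%:R; set N := letter_sum phi s.
have N0 : 0 <= N by rewrite sumr_ge0// => a _; case/andP: (phi01 a).
have Nt : N <= (size s)%:R.
  rewrite /N /letter_sum -sum1_size natr_sum; apply: ler_sum => a _.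
  by case/andP: (phi01 a).
have aE : (r + v) / x - (N - (size s)%:R * x) = r / x + ((size s)%:R - N).
  by rewrite /v; field; rewrite gt_eqF.
have bE : (r + v) / (1 - x) + (N - (size s)%:R * x) = r / (1 - x) + N.
  by rewrite /v; field; rewrite gt_eqF.
have a0 : 0 < r / x by rewrite divr_gt0.
have b0 : 0 < r / (1 - x) by rewrite divr_gt0.
rewrite beta_mixtureE ?aE ?bE; last 2 first.
- by rewrite ltr_wpDr// subr_ge0.
- by rewrite ltr_wpDr.
rewrite ler_wpM2l ?invr_ge0 ?(ltW (beta_real_gt0 _ _))//.
apply: le_Rintegral; first exact: measurable_itv.
- apply: integrable_mixture_kernel; rewrite ?aE ?bE; first by rewrite ltr_wpDr// subr_ge0.
  by rewrite ltr_wpDr.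
- by apply: integrable_beta_weightM => //; exact: continuous_likelihood.
move=> u Du; rewrite mixture_kernelE//.
have := Du; rewrite /D/= in_itv/= => /andP[u0 u1].
have u10 : 0 < 1 - u by rewrite subr_gt0.
have -> : mixture_exponent x r (N - (size s)%:R * x) v u =
    (r / x - 1) * ln u + (r / (1 - x) - 1) * ln (1 - u) +
    (N * (ln ((1 - u) / x)) + ((size s)%:R - N) * ln (u / (1 - x))).
  rewrite /mixture_exponent aE bE !ln_div ?posrE//.
  have -> : v / (1 - x) + (N - (size s)%:R * x) = N.
    by rewrite /v; field; rewrite gt_eqF.
  have -> : v / x - (N - (size s)%:R * x) = (size s)%:R - N.
    by rewrite /v; field; rewrite gt_eqF.
  by ring.
rewrite expRD expRD -!powR_expR// -/(beta_weight _ _ u) ler_wpM2l ?beta_weight_ge0//.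
rewrite /N /letter_sum /likelihood {N0 Nt aE bE v N}.
elim: s => [|a s IH]; first by rewrite !big_nil subr0 !mul0r addr0 expR0.
rewrite !big_cons.
set A := ln ((1 - u) / x) in IH *; set B := ln (u / (1 - x)) in IH *.
have -> : (phi a + \sum_(b <- s) phi b) * A +
    ((size (a :: s))%:R - (phi a + \sum_(b <- s) phi b)) * B =
  (phi a * A + (1 - phi a) * B) +
    ((\sum_(b <- s) phi b) * A + ((size s)%:R - \sum_(b <- s) phi b) * B).
  by rewrite /= -natr1; ring.
rewrite expRD ler_pM ?expR_ge0//.
have := exp_chord A B (phi01 a).
by rewrite /A /B !lnK ?posrE ?divr_gt0.
Qed.

Lemma mixture_ville Z mu phi x r alpha : iid_letters P Z mu ->
  mean_letter mu phi x -> 0 < x < 1 -> 0 < r -> 0 < alpha ->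
  (P [set w | exists t, (alpha^-1 <= beta_mixture x r
       (letter_sum phi (word Z t w) - t%:R * x) (x * (1 - x) * t%:R))%R] <= alpha%:E)%E.
Proof.
move=> hZ hphi x01 r0 a0; have [mu0 mu1 phi01 muphi] := hphi.
have /andP[x0 x1] := x01.
have B0 : 0 < beta_real (r / x) (r / (1 - x)).
  by rewrite beta_real_gt0// divr_gt0// subr_gt0.
have W0 s : 0 <= mixture_martingale phi x r s.
  rewrite mulr_ge0 ?invr_ge0 ?(ltW B0)// Rintegral_ge0// => u Du.
  by rewrite mulr_ge0 ?beta_weight_ge0// likelihood_ge0.
have Wsuper s : \sum_a mu a * mixture_martingale phi x r (rcons s a) <=
    mixture_martingale phi x r s by rewrite mixture_martingaleP.
have ia0 : 0 < alpha^-1 by rewrite invr_gt0.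
have := ville hZ mu0 W0 Wsuper ia0.
have -> : mixture_martingale phi x r [::] = 1.
  rewrite /mixture_martingale /likelihood; under eq_Rintegral do rewrite big_nil mulr1.
  by rewrite -beta_real_oo mulVf// gt_eqF.
rewrite invrK mul1r; apply: le_trans; apply: le_measure; rewrite ?inE.
- exact: (measurable_word_ex (fun t s => alpha^-1 <= beta_mixture x r
       (letter_sum phi s - t%:R * x) (x * (1 - x) * t%:R)) hZ.1).
- exact: (measurable_word_ex (fun=> fun s => alpha^-1 <= mixture_martingale phi x r s) hZ.1).
move=> w [t /le_trans h]; exists t; apply: h.
by have := beta_mixture_le_martingale (word Z t w) phi01 x01 r0; rewrite /word size_mkseq.
Qed.

End mixture_martingale.

(** * From observations to letters *)

Section letters_of_sample.
Context {d : measure_display} {Omega : measurableType d} {R : realType}.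
Variable P : probability Omega R.
Context {dX : Order.disp_t} {X : orderType dX}.
Implicit Types (xi : nat -> Omega -> X).

Definition order_measurable_cat (T : finType) (cat : X -> T) : Prop :=
  forall c, <<s order_rays X >> [set y | cat y = c].

Lemma iid_letters_cat (T : finType) (cat : X -> T) xi : iid P xi ->
  order_measurable_cat cat ->
  iid_letters P (fun i w => cat (xi i w))
    (fun c => fine (P (xi 0%N @^-1` [set y | cat y = c]))).
Proof.
move=> [mxi indep ident] mcat.
have mZ i c : measurable [set w | cat (xi i w) = c] by exact: (mxi i _ (mcat c)).
split => // s.
have [->|[c0 _]] : s = [::] \/ exists c : T, c \in s.
- by case: s => [|c s]; [left|right; exists c; rewrite mem_head].
- rewrite big_nil (_ : [set w | _] = setT) ?probability_setT//.
  by apply/seteqP; split.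
pose J := [fset i in iota 0 (size s)]%fset.
have JE i : (i \in J) = (i < size s)%N by rewrite !inE mem_iota.
rewrite (_ : [set w | _] = [set w | forall i, i \in J ->
    [set y | cat y = nth c0 s i] (xi i w)]); last first.
  apply/seteqP; split => w /=.
    move=> ws i; rewrite JE => si; rewrite -ws nth_mkseq//.
  move=> H; apply: (@eq_from_nth _ c0); first by rewrite size_mkseq.
  move=> i; rewrite size_mkseq => si; rewrite nth_mkseq//.
  by apply: H; rewrite JE.
rewrite (indep J (fun i => [set y | cat y = nth c0 s i])) => [|i _]; last exact: mcat.
have pJ : perm_eq J (iota 0 (size s)).
  by apply: uniq_perm; [exact: fset_uniq|exact: iota_uniq|move=> i; rewrite JE mem_iota].
rewrite (perm_big _ pJ)/= (big_nth c0) /index_iota subn0.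
elim: (iota _ _) => [|i l IH]; first by rewrite !big_nil.
rewrite !big_cons EFinM -IH; congr (_ * _)%E.
by rewrite ident// fineK// fin_num_measure//; exact: (mZ 0%N).
Qed.

End letters_of_sample.

Section two_sided.
Context {d : measure_display} {Omega : measurableType d} {R : realType}.
Variable P : probability Omega R.
Implicit Types (Z : nat -> Omega -> bool * bool) (mu : bool * bool -> R)
  (p r alpha : R) (f : nat -> R -> R).

Lemma sum_bool2 (F : bool * bool -> R) : \sum_a F a =
  F (true, true) + F (true, false) + (F (false, true) + F (false, false)).
Proof.
rewrite (eq_bigr (fun a => F (a.1, a.2))); last by case.
by rewrite -(pair_bigA _ (fun i j => F (i, j)))/= !big_bool.
Qed.

(** The events recorded by the two components have probabilities at most [p] and
    at least [p], and the first is almost surely contained in the second. *)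
Definition both_letters mu p : Prop :=
  [/\ forall a, 0 <= mu a, \sum_a mu a = 1, mu (true, false) = 0 &
      mu (true, true) <= p <= mu (true, true) + mu (false, true)].

Definition fst_count (s : seq (bool * bool)) : R :=
  letter_sum (fun a : bool * bool => (a.1 : nat)%:R) s.

Definition snd_count (s : seq (bool * bool)) : R :=
  letter_sum (fun a : bool * bool => (a.2 : nat)%:R) s.

(** The letters in the second event but not in the first get the value that
    completes the mean to [p]: the conditional expectation of a randomized
    tie-break, without enlarging the probability space. *)
Lemma coin_between mu p : both_letters mu p ->
  exists2 phi, mean_letter mu phi p &
    forall s, (true, false) \notin s -> fst_count s <= letter_sum phi s <= snd_count s.
Proof.
move=> [mu0 mu1 mu10 /andP[p1 p2]].
have [th th01 thE] : exists2 th : R, 0 <= th <= 1 &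
    mu (true, true) + mu (false, true) * th = p.
  have [m0|m0] := eqVneq (mu (false, true)) 0.
    exists 0; first by rewrite lexx ler01.
    by apply/eqP; rewrite mulr0 addr0 eq_le p1/= -[leRHS]addr0 -m0.
  have m1 : 0 < mu (false, true) by rewrite lt_neqAle eq_sym m0 mu0.
  exists ((p - mu (true, true)) / mu (false, true)).
    by rewrite divr_ge0 ?subr_ge0//= ler_pdivrMr// mul1r lerBlDl.
  by rewrite mulrC divfK// addrC subrK.
pose phi (a : bool * bool) : R := if a.1 then 1 else if a.2 then th else 0.
exists phi.
  split => //.
    by case=> -[] [] /=; rewrite /phi/= ?lexx ?ler01.
  by rewrite sum_bool2 /phi/= mu10 mul0r mulr0 !addr0 mulr1.
move=> s TFs; apply/andP; split.
  by apply: ler_sum => -[[] []] _; rewrite /phi//=; case/andP: th01.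
rewrite /snd_count /letter_sum big_seq [leRHS]big_seq; apply: ler_sum => a.
by case: a => -[] [] /= sa; rewrite /phi//=; [rewrite sa in TFs|case/andP: th01].
Qed.

(** Ville's inequality for the indicator that the letter has occurred: its
    initial value is 0. *)
Lemma null_letter Z mu : iid_letters P Z mu -> (forall a, 0 <= mu a) ->
  \sum_a mu a = 1 -> mu (true, false) = 0 ->
  P [set w | exists t, (true, false) \in word Z t w] = 0%E.
Proof.
move=> hZ mu0 mu1 mu10.
pose W (s : seq (bool * bool)) : R := ((true, false) \in s)%:R.
have Wsuper s : \sum_a mu a * W (rcons s a) <= W s.
  rewrite /W; case: (boolP (_ \in s)) => [sTF|sTF].
    under eq_bigr do rewrite mem_rcons inE sTF orbT mulr1.
    by rewrite mu1.
  under eq_bigr do rewrite mem_rcons inE (negbTE sTF) orbF.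
  by rewrite sum_bool2 /= mu10 !mulr0 mul0r !addr0.
have := ville hZ mu0 (fun s => ler0n R _ : 0 <= W s) Wsuper ltr01.
rewrite /W in_nil mul0r.
rewrite (_ : [set w | _] = [set w | exists t, (true, false) \in word Z t w]).
  by move=> P0; apply/eqP; rewrite eq_le P0 measure_ge0.
apply/seteqP; split => w [t] /= wt; exists t; last by rewrite wt.
by move: wt; case: (_ \in _); rewrite //= ler10.
Qed.

Lemma le_measure_off_null (A B N : set Omega) : measurable A -> measurable B ->
  measurable N -> P N = 0%E -> A `<=` B `|` N -> (P A <= P B)%E.
Proof.
move=> mA mB mN N0 AB.
apply: (@le_trans _ _ (P (B `|` N))).
  by apply: le_measure; rewrite ?inE//; exact: measurableU.
by rewrite measureU0.
Qed.

Definition two_sided_miss p f (t : nat) (s : seq (bool * bool)) : Prop :=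
  (0 < t)%N /\ (t%:R * (p + f t p) <= fst_count s \/
                snd_count s <= t%:R * (p - f t (1 - p))).

(** Both sides are instances of the one-sided bound, the lower one for the
    values [1 - phi a] of mean [1 - p]. *)
Lemma two_sided_stitched Z mu p alpha : iid_letters P Z mu -> both_letters mu p ->
  0 < p < 1 -> 0 < alpha < 1 ->
  (P [set w | exists t, two_sided_miss p (stitched_radius alpha) t (word Z t w)]
   <= alpha%:E)%E.
Proof.
move=> hZ hmu p01 a01; have [mu0 mu1 mu10 _] := hmu.
have [phi hphi phiE] := coin_between hmu; have [_ _ phi01 muphi] := hphi.
have hpsi : mean_letter mu (fun a => 1 - phi a) (1 - p).
  split => // [a|]; first by have /andP[q0 q1] := phi01 a; rewrite subr_ge0 q1 gerBl.
  by under eq_bigr do rewrite mulrBr mulr1; rewrite sumrB mu1 muphi.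
have q01 : 0 < 1 - p < 1 by case/andP: p01 => p0 p1; rewrite subr_gt0 p1 gtrBl.
pose E phi' x t (s : seq (bool * bool)) := (0 < t)%N /\
  t%:R * (x + stitched_radius alpha t x) <= letter_sum phi' s.
have mE phi' x := measurable_word_ex (E phi' x) hZ.1.
have N0 := null_letter hZ mu0 mu1 mu10.
have mN := measurable_word_ex (fun=> fun s => (true, false) \in s) hZ.1.
apply: (@le_trans _ _ (P ([set w | exists t, E phi p t (word Z t w)] `|`
    [set w | exists t, E (fun a => 1 - phi a) (1 - p) t (word Z t w)]))).
  apply: (le_measure_off_null _ _ mN N0); [exact: (measurable_word_ex _ hZ.1)|exact: measurableU|].
  move=> w [t [t0 ht]].
  have [TF|TF] := boolP ((true, false) \in word Z t w); first by right; exists t.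
  left; have /andP[h1 h2] := phiE _ TF; case: ht => ht.
    by left; exists t; split => //; exact: le_trans h1.
  right; exists t; split => //.
  rewrite /letter_sum sumrB -/(letter_sum phi _).
  have -> : \sum_(a <- word Z t w) (1 : R) = t%:R.
    by rewrite big_const_seq count_predT iter_addr_0 size_mkseq.
  have := le_trans h2 ht; lra.
apply: (le_trans (measureU2 _ _ _)) => //.
have -> : alpha%:E = ((alpha / 2)%:E + (alpha / 2)%:E)%E by rewrite -EFinD; congr EFin; lra.
by apply: leeD; apply: (stitched_one_sided hZ).
Qed.

(** No union bound: both sides force the same martingale above [alpha^-1]. *)
Lemma two_sided_mixture Z mu p r alpha : iid_letters P Z mu -> both_letters mu p ->
  0 < p < 1 -> 0 < alpha < 1 -> 0 < r ->
  (P [set w | exists t, two_sided_miss p (mixture_radius alpha r) t (word Z t w)]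
   <= alpha%:E)%E.
Proof.
move=> hZ hmu p01 /andP[al0 _] r0; have [mu0 mu1 mu10 _] := hmu.
have [phi hphi phiE] := coin_between hmu; have [_ _ phi01 muphi] := hphi.
have /andP[p0 p1] := p01.
have q01 : 0 < 1 - p < 1 by rewrite subr_gt0 p1 gtrBl.
have N0 := null_letter hZ mu0 mu1 mu10.
have mN := measurable_word_ex (fun=> fun s => (true, false) \in s) hZ.1.
apply: le_trans (mixture_ville hZ hphi p01 r0 al0).
apply: (le_measure_off_null _ _ mN N0).
- exact: (measurable_word_ex _ hZ.1).
- exact: (measurable_word_ex (fun t s => alpha^-1 <= beta_mixture p r
    (letter_sum phi s - t%:R * p) (p * (1 - p) * t%:R)) hZ.1).
move=> w [t [t0 ht]].
have [TF|TF] := boolP ((true, false) \in word Z t w); first by right; exists t.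
left; exists t; have /andP[h1 h2] := phiE _ TF.
set S := letter_sum phi _ in h1 h2 *.
have S0 : 0 <= S by rewrite sumr_ge0// => a _; case/andP: (phi01 a).
have St : S <= t%:R.
  rewrite -[t in leRHS](size_mkseq (Z^~ w)) -/(word Z t w) -sum1_size natr_sum.
  by apply: ler_sum => a _; case/andP: (phi01 a).
case: ht => ht.
  apply: mixture_radius_le => //; last by have := le_trans ht h1; lra.
  have -> : (r + p * (1 - p) * t%:R) / p = r / p + (1 - p) * t%:R.
    by field; rewrite gt_eqF.
  have : 0 < r / p by rewrite divr_gt0.
  lra.
rewrite -beta_mixtureC.
have -> : p * (1 - p) * t%:R = (1 - p) * (1 - (1 - p)) * t%:R by ring.
apply: mixture_radius_le => //; last by have := le_trans h2 ht; lra.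
have q0 : 0 < 1 - p by rewrite subr_gt0.
have -> : (r + (1 - p) * (1 - (1 - p)) * t%:R) / (1 - p) = r / (1 - p) + p * t%:R.
  by field; rewrite gt_eqF.
have : 0 < r / (1 - p) by rewrite divr_gt0.
have : 0 <= p * t%:R by rewrite mulr_ge0// ltW.
lra.
Qed.

End two_sided.

(** * Quantile miscoverage as a statement on letters *)

Section quantile_letters.
Context {d : measure_display} {Omega : measurableType d} {R : realType}.
Variable P : probability Omega R.
Context {dX : Order.disp_t} {X : orderType dX}.
Hypothesis X_complete : dedekind_complete X.
Variable xi : nat -> Omega -> X.
Hypothesis xi_iid : iid P xi.
Hypothesis xi_regular : regular_cdf P (xi 0%N).
Variable p : R.
Hypothesis p01 : 0 < p < 1.
Let F := cdf_of P (xi 0%N).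

(** If [y] is the order statistic that decides the empirical quantile, the
    empirical quantile is [ext_sup [set x | x < y]]; this set consists of the
    [y] for which it is too small. *)
Definition below_upper : set X :=
  [set y | ext_lt (ext_sup [set x | (x < y)%O]) (upper_quantile F p)].

(** The [y] for which the empirical quantile is not too large. *)
Definition below_lower : set X :=
  [set y | ~~ ext_lt (lower_quantile F p) (ext_sup [set x | (x < y)%O])].

Let ray_sub (x y : X) : (x <= y)%O -> [set z | (z < x)%O] `<=` [set z | (z < y)%O].
Proof. by move=> xy z /= zx; exact: lt_le_trans xy. Qed.

Lemma lower_set_below_upper : lower_set below_upper.
Proof.
move=> x y xy; apply: ext_le_lt_trans; apply: ext_sup_mono => //; exact: ray_sub.
Qed.

Lemma lower_set_below_lower : lower_set below_lower.
Proof.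
move=> x y xy; apply: contra => /ext_lt_le_trans; apply.
apply: ext_sup_mono => //; exact: ray_sub.
Qed.

Let mpre (A : set X) : lower_set A -> measurable (xi 0%N @^-1` A).
Proof. by move=> lA; have [mxi _ _] := xi_iid; apply: mxi; exact: lower_set_sigma. Qed.

Let cdf_mono (x y : X) : (x <= y)%O -> F x <= F y.
Proof.
move=> xy; have mle z := @mpre [set u | (u <= z)%O] (fun u v uv vz => le_trans uv vz).
apply: fine_le; rewrite ?fin_num_measure//; [exact: mle|exact: mle|].
apply: le_measure; rewrite ?inE; [exact: mle|exact: mle|].
by move=> w /= /le_trans; apply.
Qed.

Let cdfE (x : X) : P [set w | (xi 0%N w <= x)%O] = (F x)%:E.
Proof.
rewrite fineK// fin_num_measure//.
exact: (@mpre [set u | (u <= x)%O] (fun u v uv vz => le_trans uv vz)).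
Qed.

(** [below_upper] is contained in the lower set where [F <= p], whose
    probability is the supremum of the values of [F] on it. *)
Lemma below_upper_le : (P (xi 0%N @^-1` below_upper) <= p%:E)%E.
Proof.
have /andP[p0 p1] := p01.
pose A := [set x | F x <= p].
have lA : lower_set A by move=> x y xy; exact/le_trans/cdf_mono.
have sub : below_upper `<=` A.
  move=> y /= yU; apply: contrapT => nAy; move: yU; apply/negP.
  apply: ext_sup_mono => // x Ax /=; rewrite ltNge; apply/negP => yx.
  by apply: nAy; exact: lA yx Ax.
have [A0|A0] := pselect (A !=set0); last first.
  rewrite (_ : _ @^-1` _ = set0) ?measure0 ?lee_fin ?ltW//.
  by apply/seteqP; split => // w /sub ?; case: A0; exists (xi 0%N w).
apply: (@le_trans _ _ (P (xi 0%N @^-1` A))).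
  apply: le_measure; rewrite ?inE; [exact: mpre lower_set_below_upper|exact: mpre|].
  by move=> w /sub.
have -> : xi 0%N @^-1` A = [set w | exists2 s, A s & (xi 0%N w <= s)%O].
  by apply/seteqP; split => w /= [s]; [exists (xi 0%N w)|move=> As sw; exact: lA sw As].
rewrite (xi_regular A0).1; apply: ge_ereal_sup => _ [s As <-].
by rewrite cdfE lee_fin.
Qed.

(** [below_lower] contains the lower bounds of the set where [p <= F], whose
    probability is the infimum of the values of [F] on that set. *)
Lemma below_lower_ge : (p%:E <= P (xi 0%N @^-1` below_lower))%E.
Proof.
have /andP[p0 p1] := p01.
pose C := [set x | p <= F x].
have sub y : (forall x, C x -> (y <= x)%O) -> below_lower y.
  move=> yC; apply: ext_sup_mono => // x /= xy; rewrite ltNge; apply/negP => /yC.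
  by rewrite leNgt xy.
have [C0|C0] := pselect (C !=set0); last first.
  rewrite (_ : _ @^-1` _ = setT) ?probability_setT ?lee_fin ?ltW//.
  by apply/seteqP; split => // w _; apply: sub => x Cx; case: C0; exists x.
apply: (@le_trans _ _ (P [set w | forall s, C s -> (xi 0%N w <= s)%O])).
  by rewrite (xi_regular C0).2; apply: le_ereal_inf_tmp => _ [s Cs <-]; rewrite cdfE lee_fin.
apply: le_measure; rewrite ?inE; [|exact: mpre lower_set_below_lower|by move=> w /sub].
apply: (@mpre [set y | forall s, C s -> (y <= s)%O]) => x y xy yC s Cs.
exact: le_trans (yC s Cs).
Qed.

Definition quantile_letter (y : X) : bool * bool := (y \in below_upper, y \in below_lower).

Definition letter_law (c : bool * bool) : R :=
  fine (P (xi 0%N @^-1` [set y | quantile_letter y = c])).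

Lemma quantile_letter_measurable : order_measurable_cat quantile_letter.
Proof.
have [s0 sC sU] := smallest_sigma_algebra [set: X] (order_rays X).
have sT : <<s order_rays X >> [set: X] by have := sC _ s0; rewrite setD0.
have sI A B : <<s order_rays X >> A -> <<s order_rays X >> B -> <<s order_rays X >> (A `&` B).
  move=> sA sB.
  rewrite (_ : A `&` B = setT `\` \bigcup_n (setT `\` if n is 0%N then A else B)).
    by apply: (sC); apply: (sU) => -[|n]; exact: sC.
  apply/seteqP; split => [y [Ay By]|y [_ nAB]]; first by split => // -[[|n] _ [_]].
  split; apply: contrapT => nD; apply: nAB; first by exists 0%N.
  by exists 1%N.
move=> [b1 b2].
have mem_sigma (D : set X) b : lower_set D -> <<s order_rays X >> [set y | (y \in D) = b].
  move=> lD; case: b.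
    rewrite (_ : [set y | _] = D); first exact: lower_set_sigma.
    by apply/seteqP; split => y /=; [exact: set_mem|exact: mem_set].
  rewrite (_ : [set y | _] = setT `\` D); first by apply: sC; exact: lower_set_sigma.
  apply/seteqP; split => y /=; first by move=> yD; split => // /mem_set; rewrite yD.
  by move=> [_ yD]; apply/negbTE/negP => /set_mem.
rewrite (_ : [set y | _] = [set y | (y \in below_upper) = b1] `&`
    [set y | (y \in below_lower) = b2]).
  by apply: sI; apply: mem_sigma; [exact: lower_set_below_upper|exact: lower_set_below_lower].
by apply/seteqP; split => y; rewrite /quantile_letter /=; [case|case=> -> ->].
Qed.

End quantile_letters.

Section quantile_miss.
Context {d : measure_display} {Omega : measurableType d} {R : realType}.
Variable P : probability Omega R.
Context {dX : Order.disp_t} {X : orderType dX}.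
Hypothesis X_complete : dedekind_complete X.
Variable xi : nat -> Omega -> X.
Hypothesis xi_iid : iid P xi.
Hypothesis xi_regular : regular_cdf P (xi 0%N).
Variable p : R.
Hypothesis p01 : 0 < p < 1.
Let F := cdf_of P (xi 0%N).
Let D2 := below_upper P xi p.
Let D1 := below_lower P xi p.

(** The two lower sets are nested. If [below_lower] is the smaller one, both
    have probability [p] and their difference is null; this happens when [F] is
    constant, equal to [p], on an interval. *)
Lemma letter_law_both : both_letters (letter_law P xi p) p.
Proof.
pose U (D : set X) := xi 0%N @^-1` D.
have lD2 : lower_set D2 by exact: lower_set_below_upper.
have lD1 : lower_set D1 by exact: lower_set_below_lower.
have [mxi _ _] := xi_iid.
have mU D : lower_set D -> measurable (U D) by move=> lD; apply: mxi; exact: lower_set_sigma.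
have m2 := mU _ lD2; have m1 := mU _ lD1.
pose pr (A : set Omega) := fine (P A).
have fP A : measurable A -> P A = (pr A)%:E by move=> mA; rewrite fineK// fin_num_measure.
have le2 : pr (U D2) <= p by rewrite -lee_fin -fP//; exact: below_upper_le.
have le1 : p <= pr (U D1) by rewrite -lee_fin -fP//; exact: below_lower_ge.
have split A B : measurable A -> measurable B -> pr A = pr (A `\` B) + pr (A `&` B).
  move=> mA mB; apply: EFin_inj; rewrite EFinD -!fP//;
    [exact: measureDI|exact: measurableI|exact: measurableD].
have TT : letter_law P xi p (true, true) = pr (U D2 `&` U D1).
  congr (fine (P _)); apply/seteqP; split => w; rewrite /= /quantile_letter.
    by case=> /set_mem h2 /set_mem h1.
  by move=> [h2 h1]; rewrite !mem_set.
have TF : letter_law P xi p (true, false) = pr (U D2 `\` U D1).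
  congr (fine (P _)); apply/seteqP; split => w; rewrite /= /quantile_letter.
    by case=> /set_mem h2 h1; split => // h; move: h1; rewrite (mem_set (h : D1 (xi 0%N w))).
  by move=> [h2 h1]; rewrite mem_set// memNset.
have FT : letter_law P xi p (false, true) = pr (U D1 `\` U D2).
  congr (fine (P _)); apply/seteqP; split => w; rewrite /= /quantile_letter.
    by case=> h2 /set_mem h1; split => // h; move: h2; rewrite (mem_set (h : D2 (xi 0%N w))).
  by move=> [h1 h2]; rewrite (mem_set (h1 : D1 (xi 0%N w))) memNset.
have FF : letter_law P xi p (false, false) = pr (~` U D2 `\` U D1).
  congr (fine (P _)); apply/seteqP; split => w; rewrite /= /quantile_letter.
    case=> h2 h1; split => h.
      by move: h2; rewrite (mem_set (h : D2 (xi 0%N w))).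
    by move: h1; rewrite (mem_set (h : D1 (xi 0%N w))).
  by move=> [h2 h1]; rewrite !memNset.
have s2 := split _ _ m2 m1; have s1 := split _ _ m1 m2.
have sC := split _ _ (measurableC m2) m1.
have sT := split _ _ measurableT m2.
rewrite setTI setTD in sT; rewrite setIC in s1.
have CI : ~` U D2 `&` U D1 = U D1 `\` U D2 by rewrite setIC.
have PT : pr setT = 1 by rewrite /pr probability_setT.
rewrite CI in sC.
have TF0 : pr (U D2 `\` U D1) = 0.
  have [D21|D12] := lower_set_total lD2 lD1.
    rewrite (_ : _ `\` _ = set0) /pr ?measure0//.
    by apply/seteqP; split => // w [/D21].
  have : pr (U D1 `\` U D2) = 0.
    rewrite (_ : _ `\` _ = set0) /pr ?measure0//.
    by apply/seteqP; split => // w [/D12].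
  have : 0 <= pr (U D2 `\` U D1) by rewrite fine_ge0.
  by move=> h1 h2; apply/eqP; rewrite eq_le h1 andbT; lra.
split.
- by move=> c; rewrite fine_ge0.
- by rewrite sum_bool2 TT TF FT FF; lra.
- by rewrite TF.
- by rewrite TT FT; apply/andP; split; lra.
Qed.

Let letters i w := quantile_letter P xi p (xi i w).

Let sum_count (D : set X) t w : R :=
  (\sum_(i < t) (xi i w \in D))%N%:R.

Let countE (D : set X) t w : sum_count D t w = \sum_(i < t) (xi i w \in D)%:R.
Proof. by rewrite /sum_count natr_sum. Qed.

Let fst_countE t w : fst_count (word letters t w) = sum_count D2 t w.
Proof.
by rewrite /fst_count /letter_sum /word /mkseq big_map -[t in iota 0 t]subn0 big_mkord countE.
Qed.

Let snd_countE t w : snd_count (word letters t w) = sum_count D1 t w.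
Proof.
by rewrite /snd_count /letter_sum /word /mkseq big_map -[t in iota 0 t]subn0 big_mkord countE.
Qed.

Let empE t w x : (0 < t)%N ->
  t%:R * empirical_cdf xi t w x = sum_count [set z | (z <= x)%O] t w.
Proof.
move=> t0; rewrite /empirical_cdf mulrA divff ?mul1r ?pnatr_eq0 -?lt0n// countE.
by apply: eq_bigr => i _; congr (nat_of_bool _)%:R; apply/idP/idP; [exact: mem_set|exact: set_mem].
Qed.

Let sum_le_t (D : set X) t w : (\sum_(i < t) (xi i w \in D) <= t)%N.
Proof.
by rewrite -[leqRHS]card_ord -sum1_card; apply: leq_sum => i _; case: (_ \in _).
Qed.

Lemma upper_missE (q : R) t w : (0 < t)%N -> 0 < q ->
  ext_lt (lower_quantile (empirical_cdf xi t w) q) (upper_quantile F p) <->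
  t%:R * q <= fst_count (word letters t w).
Proof.
move=> t0 q0; rewrite fst_countE.
have t0R : 0 < t%:R :> R by rewrite ltr0n.
pose tau (n : nat) := t%:R * q <= n%:R.
have tau_up a b : (a <= b)%N -> tau a -> tau b.
  by move=> ab /le_trans; apply; rewrite ler_nat.
have tau0 : ~~ tau 0%N by rewrite /tau -ltNge mulr_gt0.
have EE : [set x | empirical_cdf xi t w x < q] =
    [set x | ~~ tau (\sum_(i < t) (xi i w \in [set z | (z <= x)%O]))%N].
  apply/seteqP; split => x /=; rewrite /tau -ltNge -/(sum_count _ t w) -empE//;
  by rewrite ltr_pM2l.
rewrite /lower_quantile EE.
have [taut|taut] := boolP (tau t).
  have [y yP] := order_statistic (fun i : 'I_t => xi i w) tau_up tau0 taut.
  rewrite (count_ray yP).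
  rewrite -/(tau _) yP; last exact: lower_set_below_upper.
  by split => [h|/set_mem//]; exact: mem_set.
(* Otherwise the threshold exceeds [t]: no count reaches it, and the empirical
   quantile is the supremum of [X]. *)
split => h.
  move: h; suff -> : [set x | ~~ tau (\sum_(i < t) (xi i w \in [set z | (z <= x)%O]))%N] = setT.
    by rewrite (negbTE (ext_sup_mono X_complete _)).
  apply/seteqP; split => // x _ /=; apply: contra taut; exact/tau_up/sum_le_t.
by case/negP: taut; exact: tau_up h.
Qed.

Lemma lower_missE (q : R) t w : (0 < t)%N -> q < 1 ->
  ext_lt (lower_quantile F p) (upper_quantile (empirical_cdf xi t w) q) <->
  snd_count (word letters t w) <= t%:R * q.
Proof.
move=> t0 q1; rewrite snd_countE.
have t0R : 0 < t%:R :> R by rewrite ltr0n.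
pose tau (n : nat) := t%:R * q < n%:R.
have tau_up a b : (a <= b)%N -> tau a -> tau b.
  by move=> ab /lt_le_trans; apply; rewrite ler_nat.
have taut : tau t by rewrite /tau -[ltRHS]mulr1 ltr_pM2l.
have EE : [set x | empirical_cdf xi t w x <= q] =
    [set x | ~~ tau (\sum_(i < t) (xi i w \in [set z | (z <= x)%O]))%N].
  apply/seteqP; split => x /=; rewrite /tau -leNgt -/(sum_count _ t w) -empE//;
  by rewrite ler_pM2l.
rewrite /upper_quantile EE leNgt -/(tau _).
(* If [q < 0], every count exceeds the threshold, and the empirical quantile is
   the infimum of [X]. *)
have [tau0|tau0] := boolP (tau 0%N).
  have taun n : tau n by exact: tau_up tau0.
  rewrite taun; split => //.
  rewrite (_ : [set x | _] = set0); last by apply/seteqP; split => // x /=; rewrite taun.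
  by rewrite (negbTE (ext_sup_mono X_complete _)).
have [y yP] := order_statistic (fun i : 'I_t => xi i w) tau_up tau0 taut.
rewrite (count_ray yP).
rewrite yP; last exact: lower_set_below_lower.
split => [h|].
  by apply/negP => /set_mem; rewrite /D1 /below_lower /= h.
by move=> /negP h; apply: contrapT => nh; apply: h; apply: mem_set; exact/negP.
Qed.

(** In this form the event is a countable union of events on finitely many
    letters, hence measurable. *)
Lemma miscoverage_word (f : nat -> R -> R) :
  (forall t x, (0 < t)%N -> 0 < x < 1 -> 0 <= f t x) ->
  [set w | exists t : nat, (0 < t)%N /\
      (ext_lt (lower_quantile F p)
              (upper_quantile (empirical_cdf xi t w) (p - f t (1 - p))) \/
       ext_lt (lower_quantile (empirical_cdf xi t w) (p + f t p))
              (upper_quantile F p))] =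
  [set w | exists t, two_sided_miss p f t (word letters t w)].
Proof.
move=> f0; have /andP[p0 p1] := p01.
have q01 : 0 < 1 - p < 1 by rewrite subr_gt0 p1 gtrBl.
apply/seteqP; split => w /= [t [t0 h]]; exists t; split => //.
all: have fp := f0 t p t0 p01; have fq := f0 t (1 - p) t0 q01.
all: have qu : 0 < p + f t p by lra.
all: have ql : p - f t (1 - p) < 1 by lra.
  case: h => h; first by right; exact/lower_missE.
  by left; exact/upper_missE.
case: h => h; first by right; exact/upper_missE.
by left; exact/lower_missE.
Qed.

End quantile_miss.

Theorem theorem1 (R : realType) (d : measure_display) (Omega : measurableType d)
  (P : probability Omega R) (dX : Order.disp_t) (X : orderType dX)
  (X_complete : dedekind_complete X)
  (xi : nat -> Omega -> X) (xi_iid : iid P xi) (xi_regular : regular_cdf P (xi 0%N))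
  (p alpha : R) (p01 : 0 < p < 1) (alpha01 : 0 < alpha < 1) :
  let F := cdf_of P (xi 0%N) in
  let miscoverage (f : nat -> R -> R) : set Omega :=
    [set w | exists t : nat, (0 < t)%N /\
      (ext_lt (lower_quantile F p)
              (upper_quantile (empirical_cdf xi t w) (p - f t (1 - p))) \/
       ext_lt (lower_quantile (empirical_cdf xi t w) (p + f t p))
              (upper_quantile F p))] in
  (P (miscoverage (stitched_radius alpha)) <= alpha%:E)%E /\
  (forall r : R, 0 < r ->
     (P (miscoverage (mixture_radius alpha r)) <= alpha%:E)%E).
Proof.
move=> F miscoverage.
have law := letter_law_both X_complete xi_iid xi_regular p01.
have letters := iid_letters_cat xi_iid (quantile_letter_measurable P X_complete xi p).
split => [|r r0]; rewrite /miscoverage miscoverage_word//.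
- exact: two_sided_stitched letters law p01 alpha01.
- by move=> t x t0 _; exact: stitched_radius_ge0.
- exact: two_sided_mixture letters law p01 alpha01 r0.
- by move=> t x _ _; exact: mixture_radius_ge0.
Qed.
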